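(* Let $(F_4)^\gamma=\{\alpha\in F_4\mid\gamma\alpha=\alpha\gamma\}$. Then there is an isomorphism of groups $$(F_4)^\gamma\cong(Sp(1)\times Sp(3))/\mathbb Z_2,\qquad\mathbb Z_2=\{(1,E),(-1,-E)\}.$$
   Context: $\mathbb H$ is the field of quaternions with basis $1,e_1,e_2,e_3$; the Cayley algebra is $\mathfrak C=\mathbb H\oplus\mathbb He_4$ with $(m+ae_4)(n+be_4)=(mn-\overline b a)+(a\overline n+bm)e_4$ and $\overline{m+ae_4}=\overline m-ae_4$. $\mathfrak J=\{X\in M(3,\mathfrak C)\mid X^*=X\}$ with $X\circ Y=\frac12(XY+YX)$. $F_4$ is the group of $\mathbb R$-linear isomorphisms $\alpha$ of $\mathfrak J$ with $\alpha(X\circ Y)=\alpha X\circ\alpha Y$. The involution $\gamma$ of $\mathfrak C$, $\gamma(m+ae_4)=m-ae_4$, acts on $\mathfrak J$ by applying $\gamma$ to every matrix entry; this gives $\gamma\in F_4$. $Sp(n)=\{A\in M(n,\mathbb H)\mid A^*A=E\}$, $E$ the unit matrix. *)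

(* Defs.v *)
From HB Require Import structures.
From mathcomp Require Import all_boot all_order all_algebra.
From mathcomp Require Import boolp reals.
From mathcomp Require Import ring.

Set Implicit Arguments.
Unset Strict Implicit.
Unset Printing Implicit Defensive.

Import GRing.Theory.
Local Open Scope ring_scope.

(* [Quat a b c d] is a + b e1 + c e2 + d e3, with e1 e2 = e3 (cyclically) and
   e1^2 = e2^2 = e3^2 = -1. *)
Record quat (R : Type) := Quat { q0 : R; q1 : R; q2 : R; q3 : R }.

Section Quaternion.
Variable R : realType.
Implicit Types x y z : quat R.

Definition tuple_of_quat x := (q0 x, q1 x, q2 x, q3 x).
Definition quat_of_tuple (t : R * R * R * R) :=
  let: (a, b, c, d) := t in Quat a b c d.
Fact tuple_of_quatK : cancel tuple_of_quat quat_of_tuple.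
Proof. by case. Qed.
HB.instance Definition _ := Choice.copy (quat R) (can_type tuple_of_quatK).

Definition addq x y :=
  Quat (q0 x + q0 y) (q1 x + q1 y) (q2 x + q2 y) (q3 x + q3 y).
Definition oppq x := Quat (- q0 x) (- q1 x) (- q2 x) (- q3 x).
Definition zeroq : quat R := Quat 0 0 0 0.

Fact addqA : associative addq.
Proof. by case=> ????[]????[]????; rewrite /addq /= !addrA. Qed.
Fact addqC : commutative addq.
Proof. by case=> ????[]????; congr Quat; rewrite /= addrC. Qed.
Fact add0q : left_id zeroq addq.
Proof. by case=> ????; rewrite /addq /= !add0r. Qed.
Fact addNq : left_inverse zeroq oppq addq.
Proof. by case=> ????; rewrite /addq /= !addNr. Qed.
HB.instance Definition _ :=
  GRing.isZmodule.Build (quat R) addqA addqC add0q addNq.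

Definition oneq : quat R := Quat 1 0 0 0.
Definition mulq x y :=
  Quat (q0 x * q0 y - q1 x * q1 y - q2 x * q2 y - q3 x * q3 y)
       (q0 x * q1 y + q1 x * q0 y + q2 x * q3 y - q3 x * q2 y)
       (q0 x * q2 y + q2 x * q0 y + q3 x * q1 y - q1 x * q3 y)
       (q0 x * q3 y + q3 x * q0 y + q1 x * q2 y - q2 x * q1 y).

Fact mulqA : associative mulq.
Proof. by case=> ????[]????[]????; congr Quat => /=; ring. Qed.
Fact mul1q : left_id oneq mulq.
Proof. by case=> ????; congr Quat => /=; ring. Qed.
Fact mulq1 : right_id oneq mulq.
Proof. by case=> ????; congr Quat => /=; ring. Qed.
Fact mulqDl : left_distributive mulq +%R.
Proof. by case=> ????[]????[]????; congr Quat => /=; ring. Qed.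
Fact mulqDr : right_distributive mulq +%R.
Proof. by case=> ????[]????[]????; congr Quat => /=; ring. Qed.
Fact oneq_neq0 : oneq != 0.
Proof. by apply/eqP=> -[] /eqP; rewrite oner_eq0. Qed.
HB.instance Definition _ := GRing.Zmodule_isNzRing.Build (quat R)
  mulqA mul1q mulq1 mulqDl mulqDr oneq_neq0.

Definition scaleq (a : R) x := Quat (a * q0 x) (a * q1 x) (a * q2 x) (a * q3 x).
Fact scaleqA a b x : scaleq a (scaleq b x) = scaleq (a * b) x.
Proof. by case: x => ????; rewrite /scaleq /= !mulrA. Qed.
Fact scale1q : left_id 1 scaleq.
Proof. by case=> ????; rewrite /scaleq /= !mul1r. Qed.
Fact scaleqDr : right_distributive scaleq +%R.
Proof. by move=> a []????[]????; congr Quat => /=; ring. Qed.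
Fact scaleqDl x : {morph scaleq^~ x : a b / a + b}.
Proof. by move=> a b; case: x => ????; congr Quat => /=; ring. Qed.
HB.instance Definition _ := GRing.Zmodule_isLmodule.Build R (quat R)
  scaleqA scale1q scaleqDr scaleqDl.

Fact scaleqAl (a : R) x y : a *: (x * y) = (a *: x) * y.
Proof. by case: x y => ????[]????; congr Quat => /=; ring. Qed.
HB.instance Definition _ :=
  GRing.Lmodule_isLalgebra.Build R (quat R) scaleqAl.
Fact scaleqAr (a : R) x y : a *: (x * y) = x * (a *: y).
Proof. by case: x y => ????[]????; congr Quat => /=; ring. Qed.
HB.instance Definition _ :=
  GRing.Lalgebra_isAlgebra.Build R (quat R) scaleqAr.

Definition row_of_quat x : 'rV[R]_4 :=
  \row_(i < 4) [:: q0 x; q1 x; q2 x; q3 x]`_i.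
Definition quat_of_row (u : 'rV[R]_4) : quat R :=
  Quat (u 0 0) (u 0 1) (u 0 2) (u 0 3).
Fact quat_vector_axiom : Vector.axiom 4 (quat R).
Proof.
exists row_of_quat.
  move=> a [????] [????]; apply/rowP => i; rewrite !mxE.
  by case: i => -[|[|[|[|]]]].
exists quat_of_row; first by case=> ????; rewrite /quat_of_row !mxE.
move=> u; apply/rowP => i; rewrite !mxE.
by case: i => -[|[|[|[|//]]]] lti /=; congr (u _ _); apply/val_inj.
Qed.
HB.instance Definition _ := Lmodule_hasFinDim.Build R (quat R) quat_vector_axiom.

Definition conjq x := Quat (q0 x) (- q1 x) (- q2 x) (- q3 x).

Fact conjqK : involutive conjq.
Proof. by case=> ????; rewrite /conjq /= !opprK. Qed.
Fact conjqD : {morph conjq : x y / x + y}.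
Proof. by case=> ????[]????; congr Quat => /=; ring. Qed.
Fact conjqM x y : conjq (x * y) = conjq y * conjq x.
Proof. by case: x y => ????[]????; congr Quat => /=; ring. Qed.
Fact conjq0 : conjq 0 = 0.
Proof. by congr Quat => /=; rewrite oppr0. Qed.
Fact conjq1 : conjq 1 = 1.
Proof. by congr Quat => /=; rewrite oppr0. Qed.
Fact conjqN : {morph conjq : x / - x}.
Proof. by case=> ????. Qed.
Fact conjqZ a : {morph conjq : x / a *: x}.
Proof. by case=> ????; congr Quat => /=; ring. Qed.

End Quaternion.

Section Sp.
Variable R : realType.

Definition adjq m n (A : 'M[quat R]_(m, n)) : 'M[quat R]_(n, m) :=
  (map_mx (@conjq R) A)^T.

Fact adjqM m n p (A : 'M[quat R]_(m, n)) (B : 'M[quat R]_(n, p)) :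
  adjq (A *m B) = adjq B *m adjq A.
Proof.
apply/matrixP => i j; rewrite !mxE (big_morph _ (@conjqD R) (@conjq0 R)).
by apply: eq_bigr => k _; rewrite !mxE conjqM.
Qed.

Fact adjqK m n (A : 'M[quat R]_(m, n)) : adjq (adjq A) = A.
Proof. by apply/matrixP => i j; rewrite !mxE conjqK. Qed.

Fact adjq1 n : adjq (1%:M : 'M[quat R]_n) = 1%:M.
Proof.
apply/matrixP => i j; rewrite !mxE eq_sym.
by case: eqP => _; rewrite ?conjq1 ?conjq0.
Qed.

Fact adjqN m n (A : 'M[quat R]_(m, n)) : adjq (- A) = - adjq A.
Proof. by apply/matrixP => i j; rewrite !mxE conjqN. Qed.

Let mulmx_ffun n (A : 'M[quat R]_n) (v : {ffun 'I_n -> quat R}) :=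
  [ffun i => \sum_j A i j * v j].

Let mulmx_ffun_linear n (A : 'M[quat R]_n) : linear (mulmx_ffun A).
Proof.
move=> a u v; apply/ffunP => i; rewrite !ffunE scaler_sumr -big_split /=.
by apply: eq_bigr => j _; rewrite !ffunE mulrDr scalerAr.
Qed.

Let mulmx_ffun_comp n (A B : 'M[quat R]_n) v :
  mulmx_ffun A (mulmx_ffun B v) = mulmx_ffun (A *m B) v.
Proof.
apply/ffunP => i; rewrite !ffunE.
under eq_bigr => j _ do rewrite ffunE mulr_sumr.
rewrite exchange_big; apply: eq_bigr => k _ /=; rewrite mxE mulr_suml.
by apply: eq_bigr => j _; rewrite mulrA.
Qed.

Let mulmx_ffun1 n v : mulmx_ffun (1%:M : 'M[quat R]_n) v = v.
Proof.
apply/ffunP => i; rewrite !ffunE (bigD1 i) //= mxE eqxx mul1r.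
rewrite big1 ?addr0 // => j /negPf ji.
by rewrite mxE eq_sym ji mul0r.
Qed.

(* The library has [mulmx1C] for commutative rings only. *)
Lemma mulmxq1C n (A B : 'M[quat R]_n) : A *m B = 1%:M -> B *m A = 1%:M.
Proof.
move=> AB1.
pose HB := GRing.isLinear.Build _ _ _ _ (mulmx_ffun B) (mulmx_ffun_linear B).
pose fB : {linear _ -> _} := HB.pack_for {linear _ -> _} (mulmx_ffun B) HB.
pose h := linfun fB.
have hE v : h v = mulmx_ffun B v by rewrite lfunE.
have ABK v : mulmx_ffun A (h v) = v.
  by rewrite hE mulmx_ffun_comp AB1 mulmx_ffun1.
have ker0 : lker h == 0%VS by apply/lker0P; apply: can_inj ABK.
have BAK v : mulmx_ffun (B *m A) v = v.
  rewrite -[v in LHS](lker0_lfunVK ker0) -mulmx_ffun_comp ABK -hE.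
  exact: lker0_lfunVK.
apply/matrixP => i j.
have /ffunP/(_ i) := BAK [ffun k => (k == j)%:R]; rewrite !ffunE => E.
rewrite [RHS]mxE -E (bigD1 j) //= big1 ?addr0 => [|k /negPf kj].
  by rewrite ffunE eqxx mulr1.
by rewrite ffunE kj mulr0.
Qed.

Variable n : nat.

Record Sp := MkSp { Sp_mx :> 'M[quat R]_n; _ : adjq Sp_mx *m Sp_mx == 1%:M }.
HB.instance Definition _ := [isSub for Sp_mx].
HB.instance Definition _ := [Choice of Sp by <:].

Implicit Types A B C : Sp.

Fact Sp_adjqK A : adjq A *m A = 1%:M.
Proof. exact/eqP/(valP A). Qed.

Fact Sp_mul_subproof A B :
  adjq ((A : 'M_n) *m B) *m ((A : 'M_n) *m B) == 1%:M.
Proof. by rewrite adjqM mulmxA -(mulmxA (adjq B)) Sp_adjqK mulmx1 Sp_adjqK. Qed.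
Definition Sp_mul A B := MkSp (Sp_mul_subproof A B).

Fact Sp_one_subproof : adjq 1%:M *m 1%:M == 1%:M :> 'M[quat R]_n.
Proof. by rewrite adjq1 mulmx1. Qed.
Definition Sp_one := MkSp Sp_one_subproof.

Fact Sp_inv_subproof A : adjq (adjq A) *m adjq A == 1%:M.
Proof. by rewrite adjqK; apply/eqP/mulmxq1C/Sp_adjqK. Qed.
Definition Sp_inv A := MkSp (Sp_inv_subproof A).

Fact Sp_mulA : associative Sp_mul.
Proof. by move=> A B C; apply/val_inj; rewrite /= mulmxA. Qed.
Fact Sp_mul1g : left_id Sp_one Sp_mul.
Proof. by move=> A; apply/val_inj; rewrite /= mul1mx. Qed.
Fact Sp_mulg1 : right_id Sp_one Sp_mul.
Proof. by move=> A; apply/val_inj; rewrite /= mulmx1. Qed.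
Fact Sp_mulVg : left_inverse Sp_one Sp_inv Sp_mul.
Proof. by move=> A; apply/val_inj; rewrite /= Sp_adjqK. Qed.
Fact Sp_mulgV : right_inverse Sp_one Sp_inv Sp_mul.
Proof. by move=> A; apply/val_inj/mulmxq1C/Sp_adjqK. Qed.
HB.instance Definition _ :=
  isGroup.Build Sp Sp_mulA Sp_mul1g Sp_mulg1 Sp_mulVg Sp_mulgV.

Fact Sp_minus_one_subproof : adjq (- 1%:M) *m (- 1%:M) == 1%:M :> 'M[quat R]_n.
Proof. by rewrite adjqN adjq1 mulNmx mulmxN opprK mulmx1. Qed.
Definition Sp_minus_one := MkSp Sp_minus_one_subproof.

End Sp.

(* [Cayley m a] is m + a e4. *)
Record cayley (R : Type) := Cayley { cfst : quat R; csnd : quat R }.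

Section Cayley.
Variable R : realType.
Implicit Types x y z : cayley R.

Definition pair_of_cayley x := (cfst x, csnd x).
Definition cayley_of_pair (p : quat R * quat R) := Cayley p.1 p.2.
Fact pair_of_cayleyK : cancel pair_of_cayley cayley_of_pair.
Proof. by case. Qed.
HB.instance Definition _ := Choice.copy (cayley R) (can_type pair_of_cayleyK).

Definition addo x y := Cayley (cfst x + cfst y) (csnd x + csnd y).
Definition oppo x := Cayley (- cfst x) (- csnd x).
Definition zeroo : cayley R := Cayley 0 0.

Fact addoA : associative addo.
Proof. by case=> ??[]??[]??; rewrite /addo /= !addrA. Qed.
Fact addoC : commutative addo.
Proof. by case=> ??[]??; congr Cayley; rewrite /= addrC. Qed.
Fact add0o : left_id zeroo addo.
Proof. by case=> ??; rewrite /addo /= !add0r. Qed.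
Fact addNo : left_inverse zeroo oppo addo.
Proof. by case=> ??; rewrite /addo /= !addNr. Qed.
HB.instance Definition _ :=
  GRing.isZmodule.Build (cayley R) addoA addoC add0o addNo.

Definition scaleo (a : R) x := Cayley (a *: cfst x) (a *: csnd x).
Fact scaleoA a b x : scaleo a (scaleo b x) = scaleo (a * b) x.
Proof. by case: x => ??; rewrite /scaleo /= !scalerA. Qed.
Fact scale1o : left_id 1 scaleo.
Proof. by case=> ??; rewrite /scaleo /= !scale1r. Qed.
Fact scaleoDr : right_distributive scaleo +%R.
Proof. by move=> a []??[]??; congr Cayley; rewrite /= scalerDr. Qed.
Fact scaleoDl x : {morph scaleo^~ x : a b / a + b}.
Proof. by move=> a b; case: x => ??; congr Cayley; rewrite /= scalerDl. Qed.
HB.instance Definition _ := GRing.Zmodule_isLmodule.Build R (cayley R)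
  scaleoA scale1o scaleoDr scaleoDl.

(* The multiplication is not associative, so [cayley R] is not a ring for the
   library and [*m] is not available on ['M[cayley R]_3]. *)
Definition mulo x y :=
  let: Cayley m a := x in let: Cayley n b := y in
  Cayley (m * n - conjq b * a) (a * conjq n + b * m).

Definition conjo x := Cayley (conjq (cfst x)) (- csnd x).
Definition gammao x := Cayley (cfst x) (- csnd x).

Fact muloDl : left_distributive mulo +%R.
Proof.
case=> ??[]??[]??; congr Cayley => /=.
  by rewrite mulrDl mulrDr opprD addrACA.
by rewrite mulrDl mulrDr addrACA.
Qed.
Fact muloDr : right_distributive mulo +%R.
Proof.
case=> ??[]??[]??; congr Cayley => /=.
  by rewrite conjqD mulrDr mulrDl opprD addrACA.
by rewrite conjqD mulrDr mulrDl addrACA.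
Qed.
Fact conjoD : {morph conjo : x y / x + y}.
Proof. by case=> ??[]??; congr Cayley; rewrite /= ?conjqD ?opprD. Qed.
Fact conjo0 : conjo 0 = 0.
Proof. by congr Cayley; rewrite /= ?conjq0 ?oppr0. Qed.
Fact conjoN : {morph conjo : x / - x}.
Proof. by case=> ??; congr Cayley; rewrite /= conjqN. Qed.
Fact conjoZ a : {morph conjo : x / a *: x}.
Proof. by case=> ??; congr Cayley; rewrite /= ?conjqZ ?scalerN. Qed.
Fact conjoM x y : conjo (mulo x y) = mulo (conjo y) (conjo x).
Proof.
case: x y => m a [n b]; congr Cayley => /=.
  by rewrite conjqD !conjqN !conjqM !conjqK mulrNN.
by rewrite opprD conjqK !mulNr addrC.
Qed.
Fact gammaoK : involutive gammao.
Proof. by case=> ??; rewrite /gammao /= opprK. Qed.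
Fact gammaoD : {morph gammao : x y / x + y}.
Proof. by case=> ??[]??; congr Cayley; rewrite /= opprD. Qed.
Fact gammao0 : gammao 0 = 0.
Proof. by congr Cayley; rewrite /= oppr0. Qed.
Fact gammaoZ a : {morph gammao : x / a *: x}.
Proof. by case=> ??; congr Cayley; rewrite /= scalerN. Qed.
Fact gammaoM : {morph gammao : x y / mulo x y}.
Proof.
case=> m a [n b]; congr Cayley => /=.
  by rewrite conjqN mulrNN.
by rewrite opprD !mulNr.
Qed.
Fact gammao_conjo x : gammao (conjo x) = conjo (gammao x).
Proof. by case: x. Qed.

End Cayley.

Section Jordan.
Variable R : realType.
Local Notation M3 := 'M[cayley R]_3.

Definition adjo (X : M3) : M3 := (map_mx (@conjo R) X)^T.
Definition mulmxo (X Y : M3) : M3 := \matrix_(i, j) \sum_k mulo (X i k) (Y k j).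
Definition scalemxo (a : R) (X : M3) : M3 := map_mx ( *:%R a) X.

Definition hermo : {pred M3} := [pred X | adjo X == X].

Fact hermo_zmod_closed : zmod_closed hermo.
Proof.
split=> [|X Y /eqP hX /eqP hY]; rewrite inE.
  by apply/eqP/matrixP => i j; rewrite !mxE conjo0.
by apply/eqP; rewrite -{2}hX -{2}hY; apply/matrixP => i j; rewrite !mxE conjoD conjoN.
Qed.
HB.instance Definition _ := GRing.isZmodClosed.Build M3 hermo hermo_zmod_closed.

Record jordan := MkJordan { jordan_mx :> M3; _ : jordan_mx \in hermo }.
HB.instance Definition _ := [isSub for jordan_mx].
HB.instance Definition _ := [Choice of jordan by <:].
HB.instance Definition _ := [SubChoice_isSubZmodule of jordan by <:].

Implicit Types X Y Z : jordan.

Fact jordanP X i j : conjo (X i j) = X j i.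
Proof. by have /eqP {2}<- := valP X; rewrite !mxE. Qed.

Fact jscale_subproof a X : scalemxo a X \in hermo.
Proof. by rewrite inE; apply/eqP/matrixP => i j; rewrite !mxE conjoZ jordanP. Qed.
Definition jscale a X := MkJordan (jscale_subproof a X).

Fact jscaleA a b X : jscale a (jscale b X) = jscale (a * b) X.
Proof. by apply/val_inj/matrixP => i j; rewrite !mxE scalerA. Qed.
Fact jscale1 : left_id 1 jscale.
Proof. by move=> X; apply/val_inj/matrixP => i j; rewrite !mxE scale1r. Qed.
Fact jscaleDr : right_distributive jscale +%R.
Proof. by move=> a X Y; apply/val_inj/matrixP => i j; rewrite !mxE scalerDr. Qed.
Fact jscaleDl X : {morph jscale^~ X : a b / a + b}.
Proof. by move=> a b; apply/val_inj/matrixP => i j; rewrite !mxE scalerDl. Qed.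
HB.instance Definition _ := GRing.Zmodule_isLmodule.Build R jordan
  jscaleA jscale1 jscaleDr jscaleDl.

Fact jmul_subproof X Y :
  scalemxo (2^-1) (mulmxo X Y + mulmxo Y X) \in hermo.
Proof.
rewrite inE; apply/eqP/matrixP => i j; rewrite !mxE conjoZ conjoD addrC.
congr (_ *: (_ + _)); rewrite (big_morph _ (@conjoD R) (@conjo0 R));
  by apply: eq_bigr => k _; rewrite conjoM !jordanP.
Qed.
Definition jmul X Y := MkJordan (jmul_subproof X Y).

Fact jgamma_subproof X : map_mx (@gammao R) X \in hermo.
Proof.
by rewrite inE; apply/eqP/matrixP => i j; rewrite !mxE -gammao_conjo jordanP.
Qed.
Definition jgamma X := MkJordan (jgamma_subproof X).

Definition is_F4 (f : jordan -> jordan) : Prop :=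
  [/\ linear f, bijective f & {morph f : X Y / jmul X Y}].

Record F4 := MkF4 { F4_fun :> jordan -> jordan; _ : `[< is_F4 F4_fun >] }.
HB.instance Definition _ := [isSub for F4_fun].
HB.instance Definition _ := [Choice of F4 by <:].

Implicit Types f g h : F4.

Fact F4P f : is_F4 f.
Proof. exact/asboolP/(valP f). Qed.

Fact F4_one_subproof : `[< is_F4 id >].
Proof. by apply/asboolP; split=> //; exists id. Qed.
Definition F4_one := MkF4 F4_one_subproof.

Fact F4_mul_subproof f g : `[< is_F4 (f \o g) >].
Proof.
have [fL fB fM] := F4P f; have [gL gB gM] := F4P g.
apply/asboolP; split; first by move=> a X Y; rewrite /= gL fL.
  exact: bij_comp.
by move=> X Y; rewrite /= gM fM.
Qed.
Definition F4_mul f g := MkF4 (F4_mul_subproof f g).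

Fact F4_inv_ex f : exists g : F4, cancel f g /\ cancel g f.
Proof.
have [fL [g fK gK] fM] := F4P f.
have gP : `[< is_F4 g >].
  apply/asboolP; split; last 1 first.
  - by move=> X Y; apply: (can_inj fK); rewrite fM !gK.
  - by move=> a X Y; apply: (can_inj fK); rewrite fL !gK.
  - by exists f.
by exists (MkF4 gP).
Qed.
Definition F4_inv f := sval (cid (F4_inv_ex f)).

Fact F4_mulA : associative F4_mul.
Proof. by move=> f g h; apply/val_inj. Qed.
Fact F4_mul1g : left_id F4_one F4_mul.
Proof. by move=> f; apply/val_inj. Qed.
Fact F4_mulg1 : right_id F4_one F4_mul.
Proof. by move=> f; apply/val_inj. Qed.
Fact F4_mulVg : left_inverse F4_one F4_inv F4_mul.
Proof.
move=> f; apply/val_inj/funext => X /=.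
by rewrite /F4_inv; case: cid => g [/= fK _]; rewrite fK.
Qed.
Fact F4_mulgV : right_inverse F4_one F4_inv F4_mul.
Proof.
move=> f; apply/val_inj/funext => X /=.
by rewrite /F4_inv; case: cid => g [/= _ gK]; rewrite gK.
Qed.
HB.instance Definition _ :=
  isGroup.Build F4 F4_mulA F4_mul1g F4_mulg1 F4_mulVg F4_mulgV.

Fact gamma_F4_subproof : `[< is_F4 jgamma >].
Proof.
have gK : involutive jgamma.
  by move=> X; apply/val_inj/matrixP => i j; rewrite !mxE gammaoK.
apply/asboolP; split; first 1 last.
- by exists jgamma.
- move=> X Y; apply/val_inj/matrixP => i j; rewrite !mxE gammaoZ gammaoD.
  congr (_ *: (_ + _)); rewrite (big_morph _ (@gammaoD R) (@gammao0 R));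
    by apply: eq_bigr => k _; rewrite !mxE gammaoM.
- by move=> a X Y; apply/val_inj/matrixP => i j; rewrite !mxE gammaoD gammaoZ.
Qed.
Definition gamma_F4 : F4 := MkF4 gamma_F4_subproof.

Definition commutes_gamma : pred F4 :=
  fun alpha => (gamma_F4 * alpha == alpha * gamma_F4)%g.

Definition F4_gamma := {alpha : F4 | commutes_gamma alpha}.
HB.instance Definition _ := SubChoice.on F4_gamma.

Fact commutes_gamma_group_closed : group_closed commutes_gamma.
Proof.
split=> [|f g]; rewrite !unfold_in /commutes_gamma ?mulg1 ?mul1g //.
by move=> /eqP fC /eqP gC; apply/eqP/commuteM => //; apply: commuteV.
Qed.
HB.instance Definition _ := SubChoice_isSubGroup.Build F4 commutes_gamma F4_gamma
  commutes_gamma_group_closed.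

End Jordan.

Record normal_subgroup (G : groupType) := NormalSubgroup {
  ns_pred :> {pred G};
  ns_closed : group_closed ns_pred;
  ns_normal : forall x g : G, x \in ns_pred -> (x ^ g)%g \in ns_pred }.

Section QuotientGroup.
Variables (G : groupType) (N : normal_subgroup G).
Local Open Scope quotient_scope.
Local Open Scope group_scope.
Implicit Types x y : G.

Definition coset_rel : rel G := fun x y => x^-1 * y \in ns_pred N.

Let N1 : 1 \in ns_pred N. Proof. by have [] := ns_closed N. Qed.
Let NV x : x \in ns_pred N -> x^-1 \in ns_pred N.
Proof. by have [h1 h2] := ns_closed N => Nx; rewrite -div1g; apply: h2. Qed.
Let NM x y : x \in ns_pred N -> y \in ns_pred N -> x * y \in ns_pred N.
Proof.
by have [_ h2] := ns_closed N => Nx Ny; rewrite -[y]invgK; apply/h2/NV.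
Qed.

Fact coset_rel_refl : reflexive coset_rel.
Proof. by move=> x; rewrite /coset_rel mulVg. Qed.
Fact coset_rel_sym : symmetric coset_rel.
Proof.
by move=> x y; apply/idP/idP => /NV; rewrite /coset_rel invgM invgK.
Qed.
Fact coset_rel_trans : transitive coset_rel.
Proof.
move=> y x z; rewrite /coset_rel => xy /(NM xy).
by rewrite mulgA mulgK.
Qed.
Canonical coset_equiv :=
  EquivRel coset_rel coset_rel_refl coset_rel_sym coset_rel_trans.

Definition quotient_group := {eq_quot coset_equiv}.
HB.instance Definition _ := Choice.on quotient_group.

Definition quotient_proj x : quotient_group := \pi x.

Fact quotient_projP x y :
  reflect (quotient_proj x = quotient_proj y) (x^-1 * y \in ns_pred N).
Proof. exact: eqmodP. Qed.

Fact quotient_proj_surj (u : quotient_group) : {x | u = quotient_proj x}.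
Proof. by exists (repr u); rewrite /quotient_proj reprK. Qed.

Definition quotient_one := quotient_proj 1.
Definition quotient_mul (u v : quotient_group) :=
  quotient_proj (repr u * repr v).
Definition quotient_inv (u : quotient_group) := quotient_proj (repr u)^-1.

Let proj_repr x : (repr (quotient_proj x))^-1 * x \in ns_pred N.
Proof. by apply/quotient_projP; rewrite /quotient_proj reprK. Qed.

Fact quotient_projM x y :
  quotient_mul (quotient_proj x) (quotient_proj y) = quotient_proj (x * y).
Proof.
rewrite /quotient_mul; set a := repr _; set b := repr _; apply/quotient_projP.
have Na : a^-1 * x \in ns_pred N := proj_repr x.
have Nb : b^-1 * y \in ns_pred N := proj_repr y.
have -> : (a * b)^-1 * (x * y) = (a^-1 * x) ^ b * (b^-1 * y).
  by rewrite conjgE invgM -!mulgA mulVKg.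
exact/NM/Nb/ns_normal.
Qed.

Fact quotient_projV x : quotient_inv (quotient_proj x) = quotient_proj x^-1.
Proof.
rewrite /quotient_inv; set a := repr _; apply/quotient_projP.
have /(ns_normal a^-1)/NV : a^-1 * x \in ns_pred N := proj_repr x.
by rewrite conjgE !invgK !mulgA mulgV mul1g invgF.
Qed.

Fact quotient_mulA : associative quotient_mul.
Proof.
move=> u v w; have [x ->] := quotient_proj_surj u; have [y ->] := quotient_proj_surj v.
by have [z ->] := quotient_proj_surj w; rewrite !quotient_projM mulgA.
Qed.
Fact quotient_mul1g : left_id quotient_one quotient_mul.
Proof.
by move=> u; have [x ->] := quotient_proj_surj u; rewrite quotient_projM mul1g.
Qed.
Fact quotient_mulg1 : right_id quotient_one quotient_mul.
Proof.
by move=> u; have [x ->] := quotient_proj_surj u; rewrite quotient_projM mulg1.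
Qed.
Fact quotient_mulVg : left_inverse quotient_one quotient_inv quotient_mul.
Proof.
move=> u; have [x ->] := quotient_proj_surj u.
by rewrite quotient_projV quotient_projM mulVg.
Qed.
Fact quotient_mulgV : right_inverse quotient_one quotient_inv quotient_mul.
Proof.
move=> u; have [x ->] := quotient_proj_surj u.
by rewrite quotient_projV quotient_projM mulgV.
Qed.
HB.instance Definition _ := isGroup.Build quotient_group
  quotient_mulA quotient_mul1g quotient_mulg1 quotient_mulVg quotient_mulgV.

End QuotientGroup.
Arguments quotient_group G N : clear implicits.

Definition group_isomorphic (G H : groupType) : Prop :=
  exists f : {multiplicative G -> H}, bijective f.

Section Z2.
Variable R : realType.
Local Notation G := (Sp R 1 * Sp R 3)%type.
Local Open Scope group_scope.

Let m1 : G := (Sp_minus_one R 1, Sp_minus_one R 3).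

Definition Z2_pred : {pred G} := pred2 (1, 1) m1.

Let m1_central (g : G) : m1 * g = g * m1.
Proof.
case: g => A B; congr pair; apply/val_inj;
  by rewrite /= mulNmx mulmxN mul1mx mulmx1.
Qed.

Let m1_sq : m1 * m1 = 1.
Proof.
by congr pair; apply/val_inj; rewrite /= mulNmx mulmxN mul1mx opprK.
Qed.

Fact Z2_closed : group_closed Z2_pred.
Proof.
have m1V : m1^-1 = m1 by apply: mulg1_eq; exact: m1_sq.
split=> [|x y]; rewrite !inE ?eqxx //.
by do 2![case/orP=> /eqP ->]; rewrite ?m1V ?invg1 ?mulg1 ?mul1g ?m1_sq ?eqxx ?orbT.
Qed.

Fact Z2_normal (x g : G) : x \in Z2_pred -> x ^ g \in Z2_pred.
Proof.
rewrite !inE => /orP[] /eqP ->; first by rewrite conj1g eqxx.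
by rewrite conjgE m1_central mulKg eqxx orbT.
Qed.

Definition Z2 : normal_subgroup G := NormalSubgroup Z2_closed Z2_normal.

End Z2.

(* Main.v *)
From HB Require Import structures.
Require Import Defs.
From mathcomp Require Import all_boot all_order all_algebra.
From mathcomp Require Import boolp reals.
From mathcomp Require Import ring lra.

(** Splitting each Cayley entry as [m + a e4] writes an element of J as a pair
    [M + a], with [M] a hermitian quaternionic matrix and [a] a row of three
    quaternions.  In these coordinates gamma is [M + a |-> M - a], and the Jordan
    product is given by [MN + NM], [a^* b], [a M] and real traces
    ([hpart_jmul], [vpart_jmul]).  All of these are equivariant under
    [M + a |-> A M A^* + p a A^*] for [p] in Sp(1) and [A] in Sp(3), so this
    formula defines a homomorphism from Sp(1) x Sp(3) to the centraliser of gamma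
    in F4.  An element of its kernel satisfies [p a = a A] for every [a], which
    forces [A = p E] with [p] central and of norm 1, that is [p = 1] or [p = -1]
    ([spact_F4_gamma_ker]).

    Surjectivity ([spact_F4_gamma_surj]) has three steps.  An automorphism alpha
    commuting with gamma preserves J(3,H), where the Jordan product comes from
    associative matrices; the images of the idempotents [E_ii] and of
    [E_0j + E_j0] then yield an orthonormal basis of H^3, hence [A] in Sp(3) such
    that [A^-1 alpha] fixes all these elements ([frame_unitary],
    [F4_gamma_frame]).  Such an automorphism preserves the Peirce components, and
    comparing components shows that it applies one and the same automorphism [f]
    of the Cayley algebra to every entry ([peirce_rigidity]).  Finally [f]
    commutes with gamma, so it preserves H, where it is inner by an averaging
    argument ([quat_automorphism_inner]), and it is determined by that
    restriction and the image of [e4]: [f (m + a e4)] is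
    [q m conj q + (p a conj q) e4] ([cayley_gamma_automorphism]).  This is the
    action of [(p, q E)].  The first isomorphism theorem concludes. *)

Set Implicit Arguments.
Unset Strict Implicit.
Unset Printing Implicit Defensive.

Import Order.TTheory GRing.Theory Num.Theory.
Local Open Scope ring_scope.

(** * The first isomorphism theorem *)

Lemma first_isomorphism (G H : groupType) (N : normal_subgroup G) (phi : G -> H) :
    {morph phi : x y / x * y}%g ->
    (forall h, exists g, phi g = h) ->
    (forall g, phi g = 1%g <-> g \in ns_pred N) ->
  group_isomorphic H (quotient_group G N).
Proof.
move=> phiM surj ker.
have eq_proj x y : phi x = phi y <-> quotient_proj N x = quotient_proj N y.
  have -> : phi x = phi y <-> phi (x^-1 * y)%g = 1%g.
    split=> exy; first by apply: (mulgI (phi x)); rewrite -phiM mulVKg exy mulg1.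
    by rewrite -[y in RHS](mulVKg x) phiM exy mulg1.
  by rewrite ker; split=> /quotient_projP.
pose lift h := projT1 (cid (surj h)).
have liftK h : phi (lift h) = h by exact: projT2 (cid (surj h)).
pose psi h := quotient_proj N (lift h).
have psiM : {morph psi : x y / x * y}%g.
  move=> x y; rewrite /psi [RHS]quotient_projM; apply/eq_proj.
  by rewrite phiM !liftK.
pose HB := isMultiplicative.Build _ _ psi psiM.
exists (HB.pack_for {multiplicative H -> quotient_group G N} psi HB).
exists (fun u => phi (repr u)) => [h | u] /=.
  rewrite -[RHS]liftK; apply/eq_proj.
  by rewrite /quotient_proj generic_quotient.reprK.
rewrite -[RHS]generic_quotient.reprK; apply/eq_proj; exact: liftK.
Qed.

(** * Quaternions: norm, centre and automorphisms *)

Section Quaternions.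
Variable R : realType.
Implicit Types x y : quat R.

Lemma quat_ext x y :
  q0 x = q0 y -> q1 x = q1 y -> q2 x = q2 y -> q3 x = q3 y -> x = y.
Proof. by case: x y => ????[]???? /= -> -> -> ->. Qed.

Lemma quat_eqN x : x = - x -> x = 0.
Proof. by case: x => ???? [????]; congr Quat; lra. Qed.

Definition normq x : R := q0 x ^+ 2 + q1 x ^+ 2 + q2 x ^+ 2 + q3 x ^+ 2.

Lemma mulq_conjl x : conjq x * x = (normq x)%:A.
Proof. by case: x => a b c d; congr Quat => /=; rewrite /normq /=; ring. Qed.

Lemma mulq_conjr x : x * conjq x = (normq x)%:A.
Proof. by case: x => a b c d; congr Quat => /=; rewrite /normq /=; ring. Qed.

Lemma normq_ge0 x : 0 <= normq x.
Proof. by rewrite /normq !addr_ge0 ?sqr_ge0. Qed.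

Lemma normq_eq0 x : (normq x == 0) = (x == 0).
Proof.
apply/idP/eqP => [|->]; last by rewrite /normq /= expr0n /= !addr0.
rewrite /normq !paddr_eq0 ?addr_ge0 ?sqr_ge0 // !sqrf_eq0.
by case: x => a b c d /= /andP[/andP[/andP[/eqP-> /eqP->] /eqP->] /eqP->].
Qed.

Lemma normqZ r x : normq (r *: x) = r ^+ 2 * normq x.
Proof. by rewrite /normq /=; ring. Qed.

Lemma normqM x y : normq (x * y) = normq x * normq y.
Proof. by case: x y => ????[]????; rewrite /normq /=; ring. Qed.

Lemma normq_gt0 x : x != 0 -> 0 < normq x.
Proof. by rewrite lt_def normq_ge0 normq_eq0 andbT. Qed.

Lemma normq_normalize x :
  x != 0 -> normq ((Num.sqrt (normq x))^-1 *: x) = 1.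
Proof.
move=> x0; rewrite normqZ exprVn sqr_sqrtr ?normq_ge0 //.
by rewrite mulVf // normq_eq0.
Qed.

Lemma q0_mulC x y : q0 (x * y) = q0 (y * x).
Proof. by rewrite /=; ring. Qed.

Lemma quat_alg_central r x : x * r%:A = r%:A * x.
Proof. by rewrite mulr_algl mulr_algr. Qed.

Lemma conjq_alg r : conjq (r%:A : quat R) = r%:A.
Proof. by rewrite conjqZ conjq1. Qed.

Lemma conjq_fixed x : conjq x = x -> x = (q0 x)%:A.
Proof.
by case: x => a b c d [h1 h2 h3]; congr Quat => /=; lra.
Qed.

Lemma quat_central x : (forall y, x * y = y * x) -> x = (q0 x)%:A.
Proof.
move=> xC; have := xC (Quat 0 1 0 0); have := xC (Quat 0 0 1 0).
by case: x {xC} => a b c d [? ? ? ?] [? ? ? ?]; congr Quat => /=; lra.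
Qed.

Lemma unit_quat_central x :
  normq x = 1 -> (forall y, x * y = y * x) -> x = 1 \/ x = -1.
Proof.
move=> nx /quat_central ex; move: nx; rewrite ex normqZ.
rewrite (_ : normq 1 = 1) ?mulr1 => [/eqP|]; last first.
  by rewrite /normq /= expr1n expr0n /= !addr0.
by rewrite sqrf_eq1 => /orP[] /eqP->; [left|right]; rewrite ?scaleN1r ?scale1r.
Qed.

Section InnerAutomorphism.
Variable g : quat R -> quat R.
Hypothesis gL : linear g.
Hypothesis gM : {morph g : x y / x * y}.
Hypothesis g1 : g 1 = 1.

Let i1 : quat R := Quat 0 1 0 0.
Let i2 : quat R := Quat 0 0 1 0.
Let i3 : quat R := Quat 0 0 0 1.

Let gE x : g x = (q0 x)%:A + q1 x *: g i1 + q2 x *: g i2 + q3 x *: g i3.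
Proof.
pose HB := GRing.isLinear.Build _ _ _ _ g gL.
pose gl : {linear quat R -> quat R} := HB.pack_for {linear _ -> _} g HB.
have {1}-> : x = (q0 x)%:A + q1 x *: i1 + q2 x *: i2 + q3 x *: i3.
  by case: x => a b c d; congr Quat => /=; ring.
have ge y : g y = gl y by [].
by rewrite !ge !linearD !linearZ /= g1.
Qed.

(** Four times the average of [g u * y * u^-1] over the eight units [u] equal
    to 1, e1, e2, e3 or an opposite of these.  Reindexing the average by
    left translation shows that it intertwines [g] with the identity. *)
Let twirl y := y - g i1 * y * i1 - g i2 * y * i2 - g i3 * y * i3.

Let twirlP x y : g x * twirl y = twirl y * x.
Proof.
have gN z : g (- z) = - g z.
  by rewrite (gE (- z)) (gE z) /= !scaleNr !opprD.
have sq1 : g i1 * g i1 = -1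
  by rewrite -gM -[X in - X]g1 -gN; congr g; congr Quat => /=; ring.
have sq2 : g i2 * g i2 = -1
  by rewrite -gM -[X in - X]g1 -gN; congr g; congr Quat => /=; ring.
have sq3 : g i3 * g i3 = -1
  by rewrite -gM -[X in - X]g1 -gN; congr g; congr Quat => /=; ring.
have m12 : g i1 * g i2 = g i3 by rewrite -gM; congr g; congr Quat => /=; ring.
have m23 : g i2 * g i3 = g i1 by rewrite -gM; congr g; congr Quat => /=; ring.
have m31 : g i3 * g i1 = g i2 by rewrite -gM; congr g; congr Quat => /=; ring.
have m21 : g i2 * g i1 = - g i3
  by rewrite -gM -gN; congr g; congr Quat => /=; ring.
have m32 : g i3 * g i2 = - g i1
  by rewrite -gM -gN; congr g; congr Quat => /=; ring.
have m13 : g i1 * g i3 = - g i2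
  by rewrite -gM -gN; congr g; congr Quat => /=; ring.
rewrite gE !mulrDl !mulr_algl -!scalerAl /twirl !mulrBr !mulrA.
rewrite sq1 sq2 sq3 m12 m23 m31 m21 m32 m13.
case: (g i1) => ????; case: (g i2) => ????; case: (g i3) => ????.
by case: x y => ????[]????; congr Quat => /=; ring.
Qed.

(** For basis elements [e] and [u], the sum over [e] of [e conj u conj e] is
    four times the real part of [u].  Summing [twirl e * conj e] over [e]
    therefore leaves only the term [u = 1], which is [4 * g 1]. *)
Let twirl_neq0 : exists y, twirl y != 0.
Proof.
have sumE : twirl 1 - twirl i1 * i1 - twirl i2 * i2 - twirl i3 * i3 = 4%:A.
  rewrite /twirl; case: (g i1) => ????; case: (g i2) => ????.
  by case: (g i3) => ????; congr Quat => /=; ring.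
apply: contrapT => /forallNP n0.
have t0 y : twirl y = 0 by apply/eqP; have /negP := n0 y; rewrite negbK.
by move: sumE; rewrite !t0 !mul0r !subr0 => -[] /eqP; rewrite mulr1 eq_sym pnatr_eq0.
Qed.

(** Skolem-Noether for the quaternions: a nonzero twirl [t] satisfies
    [g x * t = t * x], and its normalisation is the conjugating element. *)
Lemma quat_automorphism_inner :
  exists2 q, normq q = 1 & forall x, g x = q * x * conjq q.
Proof.
have [y ty] := twirl_neq0.
exists ((Num.sqrt (normq (twirl y)))^-1 *: twirl y); first exact: normq_normalize.
set r := _^-1 => x; have nq := normq_normalize ty; rewrite -/r in nq.
by rewrite -scalerAl -twirlP scalerAr -mulrA mulq_conjr nq scale1r mulr1.
Qed.
End InnerAutomorphism.
End Quaternions.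

(** * Quaternionic matrices *)

Section QuaternionicMatrices.
Variable R : realType.

Lemma adjq_scalar n (c : quat R) : adjq (c%:M : 'M_n) = (conjq c)%:M.
Proof.
apply/matrixP => i j; rewrite !mxE eq_sym.
by case: eqP => _; rewrite ?conjq0.
Qed.

Lemma mulmx_realZ m n p (r : R) (A : 'M[quat R]_(m, n)) (B : 'M_(n, p)) :
  A *m (r%:A *: B) = r%:A *: (A *m B).
Proof.
apply/matrixP => i j; rewrite !mxE mulr_sumr; apply: eq_bigr => k _.
by rewrite mxE !mulrA quat_alg_central.
Qed.

Lemma adjqZ m n (r : R) (A : 'M[quat R]_(m, n)) : adjq (r%:A *: A) = r%:A *: adjq A.
Proof. by apply/matrixP => i j; rewrite !mxE conjqM conjq_alg quat_alg_central. Qed.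

Lemma mxq_double_inj m n (A B : 'M[quat R]_(m, n)) : A + A = B + B -> A = B.
Proof.
move=> /matrixP AB; apply/matrixP => i j; have := AB i j; rewrite !mxE.
case: (A i j) (B i j) => ????[]???? [????].
by congr Quat; lra.
Qed.

(** The trace itself is not cyclic over a noncommutative ring; its real part
    is, because [q0 (x * y) = q0 (y * x)]. *)
Definition retr n (A : 'M[quat R]_n) : R := q0 (\tr A).

Fact q0D : {morph @q0 R : x y / x + y}. Proof. by []. Qed.

Lemma retrM m n (A : 'M[quat R]_(m, n)) (B : 'M_(n, m)) :
  retr (A *m B) = retr (B *m A).
Proof.
rewrite /retr /mxtrace !(big_morph _ q0D (erefl : q0 0 = 0)).
under eq_bigr => i _ do rewrite mxE (big_morph _ q0D (erefl : q0 0 = 0)).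
under [RHS]eq_bigr => i _ do rewrite mxE (big_morph _ q0D (erefl : q0 0 = 0)).
rewrite exchange_big /=; apply: eq_bigr => j _; apply: eq_bigr => i _.
exact: q0_mulC.
Qed.

End QuaternionicMatrices.

(** * Indices modulo 3 *)

Section Ord3.
Lemma ord3_cases (P : 'I_3 -> Prop) : P 0 -> P 1 -> P 2%R -> forall i, P i.
Proof.
by move=> h0 h1 h2 [[|[|[|//]]] lti]; [move: h0|move: h1|move: h2];
  congr P; apply/val_inj.
Qed.
Lemma sum3 (V : nmodType) (F : 'I_3 -> V) : \sum_i F i = F 0 + F 1 + F 2%R.
Proof.
rewrite !big_ord_recl big_ord0 addr0 addrA; congr (F _ + F _ + F _);
exact/val_inj.
Qed.
Lemma i3_11 : 1 + 1 = 2 :> 'I_3. Proof. exact/val_inj. Qed.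
Lemma i3_12 : 1 + 2 = 0 :> 'I_3. Proof. exact/val_inj. Qed.
Lemma i3_21 : 2 + 1 = 0 :> 'I_3. Proof. exact/val_inj. Qed.
Lemma i3_22 : 2 + 2 = 1 :> 'I_3. Proof. exact/val_inj. Qed.
Definition ord3E := (add0r, i3_11, i3_12, i3_21, i3_22).
End Ord3.

(** * The decomposition of J into J(3,H) and H^3, and its product *)

Section Jordan.
Variable R : realType.
Implicit Types X Y : jordan R.
Implicit Types a b : 'rV[quat R]_3.

Definition hpart X : 'M[quat R]_3 := map_mx (@cfst R) X.
(** The index arithmetic is modulo 3: [vpart X] collects the [e4]-components of
    the entries (1,2), (2,0), (0,1).  Since [conj (m + a e4) = conj m - a e4],
    hermitian symmetry makes the [e4]-part of [X] antisymmetric, so these three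
    entries determine it. *)
Definition vpart X : 'rV[quat R]_3 := \row_i csnd (X (i + 1) (i + 2)).
(** Up to sign, the matrix of the cross product with [a]. *)
Definition crossmx a : 'M[quat R]_3 :=
  \matrix_(i, j) if j == i + 1 then a 0 (i + 2)
                 else if i == j + 1 then - a 0 (j + 2) else 0.

Lemma crossmxE a :
    (crossmx a 0 0 = 0) * (crossmx a 1 1 = 0) * (crossmx a 2%R 2%R = 0)
  * (crossmx a 1 2%R = a 0 0) * (crossmx a 2%R 1 = - a 0 0)
  * (crossmx a 2%R 0 = a 0 1) * (crossmx a 0 2%R = - a 0 1)
  * (crossmx a 0 1 = a 0 2%R) * (crossmx a 1 0 = - a 0 2%R).
Proof. by rewrite !mxE !ord3E. Qed.

Lemma csnd_diag X i : csnd (X i i) = 0.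
Proof.
have /(congr1 (@csnd R)) /= /eqP := jordanP X i i.
rewrite eq_sym -subr_eq0 opprK -mulr2n -scaler_nat scaler_eq0.
by rewrite pnatr_eq0 /= => /eqP.
Qed.

Lemma csnd_crossmx X i j : csnd (X i j) = crossmx (vpart X) i j.
Proof.
have sC k l : csnd (X k l) = - csnd (X l k) by rewrite -[in LHS]jordanP.
move: i j; apply: ord3_cases; apply: ord3_cases;
 rewrite crossmxE ?mxE ?ord3E ?csnd_diag //; exact: sC.
Qed.

Lemma hpart_herm X : adjq (hpart X) = hpart X.
Proof. by apply/matrixP => i j; rewrite !mxE -[in RHS]jordanP. Qed.

Lemma jordan_ext X Y : hpart X = hpart Y -> vpart X = vpart Y -> X = Y.
Proof.
move=> eh ev; apply/val_inj/matrixP => i j /=.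
have := csnd_crossmx X i j; rewrite ev -csnd_crossmx.
have /matrixP/(_ i j) := eh; rewrite !mxE.
by case: (X i j) (Y i j) => ? ? [? ?] /= -> ->.
Qed.

Lemma crossmx_antisym a i j : crossmx a j i = - crossmx a i j.
Proof.
by move: i j; apply: ord3_cases; apply: ord3_cases; rewrite !crossmxE ?opprK ?oppr0.
Qed.

Section Mk.
Variables (M : 'M[quat R]_3) (a : 'rV[quat R]_3).
Hypothesis hM : adjq M = M.
Fact mkjordan_subproof : (\matrix_(i, j) Cayley (M i j) (crossmx a i j)) \in @hermo R.
Proof.
rewrite inE; apply/eqP/matrixP => i j; rewrite mxE mxE [X in conjo X]mxE [RHS]mxE.
rewrite /conjo; congr Cayley; last by rewrite /= [crossmx a j i]crossmx_antisym opprK.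
by have /matrixP/(_ i j) := hM; rewrite !mxE.
Qed.
Definition mkjordan := MkJordan mkjordan_subproof.
Lemma hpart_mk : hpart mkjordan = M.
Proof. by apply/matrixP => i j; rewrite !mxE. Qed.
Lemma vpart_mk : vpart mkjordan = a.
Proof.
by apply/rowP; apply: ord3_cases; rewrite mxE !ord3E [jordan_mx _ _ _]mxE /= crossmxE.
Qed.
End Mk.

Lemma hpart_linear c X Y : hpart (c *: X + Y) = c%:A *: hpart X + hpart Y.
Proof. by apply/matrixP => i j; rewrite !mxE /= mulr_algl. Qed.
Lemma vpart_linear c X Y : vpart (c *: X + Y) = c%:A *: vpart X + vpart Y.
Proof. by apply/rowP => i; rewrite !mxE /= mulr_algl. Qed.

(** The contraction of two Levi-Civita symbols, with the conjugations and the
    order of the factors that the Cayley product imposes. *)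
Lemma crossmx_mul a b i j :
  \sum_k conjq (crossmx b k j) * crossmx a i k =
  conjq (b 0 i) * a 0 j - (\sum_l conjq (b 0 l) * a 0 l) *+ (i == j).
Proof.
rewrite !sum3; move: i j; apply: ord3_cases; apply: ord3_cases;
  rewrite !crossmxE !(mulr0, conjq0, mul0r, addr0, add0r, conjqN, mulrN, mulNr, opprK) /=.
all: by rewrite ?subr0 // mulr1n; apply: quat_ext => /=; ring.
Qed.

Lemma adjq_mul_rowE a b i j : (adjq a *m b) i j = conjq (a 0 i) * b 0 j.
Proof. by rewrite mxE big_ord1 !mxE. Qed.

(** The first half of the product formula
    [2 (M + a) o (N + b) = (MN + NM - a^* b - b^* a + 2 Re tr (a^* b) E)
       + (tr(M) b - b M + tr(N) a - a N)].
    Every term on the right is built from operations that are equivariant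
    under [M |-> A M A^*], [a |-> p a A^*]. *)
Lemma hpart_jmul X Y : hpart (jmul X Y) =
  2^-1%:A *: (hpart X *m hpart Y + hpart Y *m hpart X
              - adjq (vpart X) *m vpart Y - adjq (vpart Y) *m vpart X)
  + (retr (adjq (vpart X) *m vpart Y))%:A%:M.
Proof.
set a := vpart X; set b := vpart Y.
pose S (u v : 'rV[quat R]_3) := \sum_l conjq (u 0 l) * v 0 l.
have prodE (Z W : jordan R) i j : cfst (\sum_k mulo (Z i k) (W k j)) =
    (hpart Z *m hpart W) i j
    - (conjq (vpart W 0 i) * vpart Z 0 j - S (vpart W) (vpart Z) *+ (i == j)).
  rewrite -crossmx_mul mxE -sumrB (big_morph (@cfst R) (id1 := 0) (op1 := +%R)) //.
  apply: eq_bigr => k _; rewrite -!csnd_crossmx !mxE.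
  by case: (Z i k) (W k j) => ? ? [].
have reE : S b a + S a b = (retr (adjq a *m b) *+ 2)%:A.
  rewrite /S retrM /retr /mxtrace big_ord1 [X in q0 X]mxE !sum3 !mxE.
  by apply: quat_ext => /=; ring.
have entryE (P Q C D : 'M[quat R]_3) c i j :
    (2^-1%:A *: (P + Q - C - D) + c%:M) i j =
    2^-1 *: (P i j + Q i j - C i j - D i j) + c *+ (i == j).
  by rewrite !mxE mulr_algl.
apply/matrixP => i j; rewrite entryE !adjq_mul_rowE.
transitivity (2^-1 *: (cfst (\sum_k mulo (X i k) (Y k j))
                       + cfst (\sum_k mulo (Y i k) (X k j)))).
  by rewrite !mxE.
rewrite !prodE -/a -/b.
transitivity (2^-1 *: ((hpart X *m hpart Y) i j + (hpart Y *m hpart X) i j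
   - conjq (a 0 i) * b 0 j - conjq (b 0 i) * a 0 j + (S b a + S a b) *+ (i == j))).
  rewrite mulrnDl; congr (_ *: _); move: (_ *+ _) (_ *+ _) (_ * _) (_ * _).
  move: (_ i j) (_ i j) => P Q s t c d.
  by apply: quat_ext => /=; ring.
rewrite reE scalerDr; congr (_ + _); rewrite -scalerMnr scalerA; congr (_ %:A *+ _).
by field.
Qed.

(** The second half.  Diagonal entries of a hermitian matrix are real, so its
    trace is real and may be replaced by [retr]. *)
Lemma vpart_jmul X Y : vpart (jmul X Y) =
  2^-1%:A *: ((retr (hpart X))%:A *: vpart Y - vpart Y *m hpart X
            + ((retr (hpart Y))%:A *: vpart X - vpart X *m hpart Y)).
Proof.
have herm Z i j : hpart Z j i = conjq (hpart Z i j).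
  by rewrite -{1}hpart_herm !mxE.
have prodE (Z W : jordan R) i j : csnd (\sum_k mulo (Z i k) (W k j)) =
    \sum_k (crossmx (vpart Z) i k * hpart W j k + crossmx (vpart W) k j * hpart Z i k).
  rewrite (big_morph (@csnd R) (id1 := 0) (op1 := +%R)) //.
  apply: eq_bigr => k _; rewrite -!csnd_crossmx (herm W k j) !mxE.
  by case: (Z i k) (W k j) => ? ? [? ?] /=.
have half (s : R) (P Q U V : 'rV[quat R]_3) i :
  (s%:A *: (P - Q + (U - V))) 0 i = s *: (P 0 i - Q 0 i + (U 0 i - V 0 i)).
  by rewrite !mxE mulr_algl.
apply/rowP => i; rewrite half.
transitivity (2^-1 *: (csnd (\sum_k mulo (X (i + 1) k) (Y k (i + 2)))
                       + csnd (\sum_k mulo (Y (i + 1) k) (X k (i + 2))))).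
  by rewrite !mxE.
rewrite !prodE; congr (_ *: _).
move: (hpart X) (hpart Y) (vpart X) (vpart Y) (herm X) (herm Y) => M N a b hM hN.
have diag (Z : 'M[quat R]_3) : (forall k l, Z l k = conjq (Z k l)) ->
    forall k, Z k k = (q0 (Z k k))%:A.
  by move=> hZ k; apply: conjq_fixed; rewrite -hZ.
rewrite !mxE /retr /mxtrace !sum3 /=.
move: i; apply: ord3_cases; rewrite !ord3E !crossmxE.
all: rewrite ?(hM 0 1) ?(hM 0 2%R) ?(hM 1 2%R) ?(hN 0 1) ?(hN 0 2%R) ?(hN 1 2%R).
all: rewrite (diag M hM 0) (diag M hM 1) (diag M hM 2%R).
all: rewrite (diag N hN 0) (diag N hN 1) (diag N hN 2%R).
all: by apply: quat_ext => /=; ring.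
Qed.

End Jordan.

(** * The action of Sp(1) x Sp(3) and its kernel *)

Section Action.
Variable R : realType.
Implicit Types X Y : jordan R.

Lemma hpart_jgamma X : hpart (jgamma X) = hpart X.
Proof. by apply/matrixP => i j; rewrite !mxE. Qed.
Lemma vpart_jgamma X : vpart (jgamma X) = - vpart X.
Proof. by apply/rowP => i; rewrite !mxE. Qed.

Fact conj_herm n (A M : 'M[quat R]_n) :
  adjq M = M -> adjq (A *m M *m adjq A) = A *m M *m adjq A.
Proof. by move=> hM; rewrite !adjqM adjqK hM mulmxA. Qed.

(** [M + a |-> A M A^* + p a A^*].  Taking plain matrices rather than elements
    of Sp(1) and Sp(3) makes functoriality in [(p, A)] an identity between
    matrix products. *)
Definition spact (p : 'M[quat R]_1) (A : 'M[quat R]_3) X : jordan R :=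
  mkjordan (p *m vpart X *m adjq A) (conj_herm A (hpart_herm X)).

Lemma hpart_spact p A X : hpart (spact p A X) = A *m hpart X *m adjq A.
Proof. exact: hpart_mk. Qed.
Lemma vpart_spact p A X : vpart (spact p A X) = p *m vpart X *m adjq A.
Proof. exact: vpart_mk. Qed.

Lemma spact_mul p q A B X :
  spact (p *m q) (A *m B) X = spact p A (spact q B X).
Proof.
by apply: jordan_ext; rewrite !(hpart_spact, vpart_spact) adjqM !mulmxA.
Qed.

Lemma spact1 X : spact 1%:M 1%:M X = X.
Proof.
by apply: jordan_ext; rewrite !(hpart_spact, vpart_spact) adjq1 mulmx1 mul1mx.
Qed.

Lemma spact_linear p A : linear (spact p A).
Proof.
move=> c X Y; apply: jordan_ext.
  rewrite hpart_linear !hpart_spact hpart_linear mulmxDr mulmxDl.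
  by rewrite mulmx_realZ -scalemxAl.
rewrite vpart_linear !vpart_spact vpart_linear mulmxDr mulmxDl.
by rewrite mulmx_realZ -scalemxAl.
Qed.

Lemma spact_jgamma p A X : spact p A (jgamma X) = jgamma (spact p A X).
Proof.
apply: jordan_ext; rewrite ?hpart_spact ?vpart_spact.
  by rewrite !hpart_jgamma hpart_spact.
by rewrite !vpart_jgamma vpart_spact mulmxN mulNmx.
Qed.

Section Unitary.
Variables (p : 'M[quat R]_1) (A : 'M[quat R]_3).
Hypotheses (hp : adjq p *m p = 1%:M) (hA : adjq A *m A = 1%:M).

Let cj (M : 'M[quat R]_3) := A *m M *m adjq A.
Let tw (a : 'rV[quat R]_3) := p *m a *m adjq A.

Let cjD M N : cj (M + N) = cj M + cj N.
Proof. by rewrite /cj mulmxDr mulmxDl. Qed.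
Let cjN M : cj (- M) = - cj M.
Proof. by rewrite /cj mulmxN mulNmx. Qed.
Let cjZ (r : R) M : cj (r%:A *: M) = r%:A *: cj M.
Proof. by rewrite /cj mulmx_realZ -scalemxAl. Qed.
Let cj1 : cj 1%:M = 1%:M.
Proof. by rewrite /cj mulmx1; apply: mulmxq1C. Qed.
Let cjM M N : cj M *m cj N = cj (M *m N).
Proof. by rewrite /cj !mulmxA -(mulmxA _ (adjq A)) hA mulmx1. Qed.
Let cj_retr M : retr (cj M) = retr M.
Proof. by rewrite /cj -mulmxA retrM -mulmxA hA mulmx1. Qed.
Let twD a b : tw (a + b) = tw a + tw b.
Proof. by rewrite /tw mulmxDr mulmxDl. Qed.
Let twN a : tw (- a) = - tw a.
Proof. by rewrite /tw mulmxN mulNmx. Qed.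
Let twZ (r : R) a : tw (r%:A *: a) = r%:A *: tw a.
Proof. by rewrite /tw mulmx_realZ -scalemxAl. Qed.
Let twM a M : tw a *m cj M = tw (a *m M).
Proof. by rewrite /cj /tw !mulmxA -(mulmxA _ (adjq A)) hA mulmx1. Qed.
Let tw_rank1 a b : adjq (tw a) *m tw b = cj (adjq a *m b).
Proof.
by rewrite /tw /cj !adjqM adjqK !mulmxA -(mulmxA _ (adjq p)) hp mulmx1.
Qed.

(** Each term of the product formula is equivariant: [A^* A = 1] cancels in
    the matrix products and under the real trace, [p^* p = 1] cancels in
    [a^* b], and [A A^* = 1] fixes the unit matrix. *)
Lemma spact_jmul X Y : spact p A (jmul X Y) = jmul (spact p A X) (spact p A Y).
Proof.
have hE Z : hpart (spact p A Z) = cj (hpart Z) by exact: hpart_spact.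
have vE Z : vpart (spact p A Z) = tw (vpart Z) by exact: vpart_spact.
apply: jordan_ext.
  rewrite hE !hpart_jmul !hE !vE.
  move: (hpart X) (hpart Y) (vpart X) (vpart Y) => M N a b.
  rewrite !tw_rank1 !cjM cj_retr -[(retr _)%:A%:M]scalemx1 cjD !cjZ cj1.
  by rewrite !cjD !cjN.
rewrite vE !vpart_jmul !hE !vE.
move: (hpart X) (hpart Y) (vpart X) (vpart Y) => M N a b.
by rewrite !cj_retr !twM twZ twD !twD !twN !twZ.
Qed.
End Unitary.

Section SpActF4.
Variable g : Sp R 1 * Sp R 3.

Fact spact_F4_subproof : `[< is_F4 (spact g.1 g.2) >].
Proof.
have p1 := Sp_adjqK g.1; have A1 := Sp_adjqK g.2.
apply/asboolP; split; first exact: spact_linear.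
  exists (spact (adjq g.1) (adjq g.2)) => X; rewrite -spact_mul.
    by rewrite p1 A1 spact1.
  by rewrite (mulmxq1C p1) (mulmxq1C A1) spact1.
exact: spact_jmul.
Qed.
Definition spact_F4 : F4 R := MkF4 spact_F4_subproof.

Fact spact_commutes_gamma : commutes_gamma spact_F4.
Proof.
by apply/eqP/val_inj/funext => X /=; rewrite spact_jgamma.
Qed.
Definition spact_F4_gamma : F4_gamma R := exist _ spact_F4 spact_commutes_gamma.
End SpActF4.

Lemma spact_F4_gammaM : {morph spact_F4_gamma : g h / g * h}%g.
Proof.
by move=> g h; apply/val_inj/val_inj/funext => X; exact: spact_mul.
Qed.

(** Acting trivially on the vector part means [p a = a A] for every row [a].
    Testing on multiples of the basis rows makes [A] scalar with entry [p], and
    [p] central. *)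
Lemma spact_id_scalar p A : adjq A *m A = 1%:M -> (forall X, spact p A X = X) ->
  A = (p 0 0)%:M /\ forall y, p 0 0 * y = y * p 0 0.
Proof.
move=> hA idX.
have com (a : 'rV[quat R]_3) : p *m a = a *m A.
  have h0 : adjq 0 = 0 :> 'M[quat R]_3.
    by apply/matrixP => i j; rewrite !mxE conjq0.
  have := congr1 (@vpart R) (idX (mkjordan a h0)).
  rewrite vpart_spact vpart_mk => aE.
  by rewrite -[in RHS]aE -mulmxA hA mulmx1.
have entry x i j : p 0 0 * (x *+ (i == j)) = x * A i j.
  have /rowP/(_ j) := com (\row_k (x *+ (i == k))).
  rewrite !mxE big_ord1 !mxE (bigD1 i) //= mxE eqxx big1 ?addr0 // => k /negPf ki.
  by rewrite mxE eq_sym ki mul0r.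
have AE i j : A i j = p 0 0 *+ (i == j).
  by have := entry 1 i j; rewrite mul1r mulrnAr mulr1 => <-.
split=> [|y]; first by apply/matrixP => i j; rewrite AE mxE.
by have := entry y 0 0; rewrite AE eqxx.
Qed.

Lemma spact_F4_gamma_ker g : spact_F4_gamma g = 1%g <-> g \in ns_pred (Z2 R).
Proof.
have scalarN n : (-1)%:M = - 1%:M :> 'M[quat R]_n by rewrite raddfN.
split=> [/(congr1 val)/(congr1 val) idg | ].
  have idX X : spact g.1 g.2 X = X by exact: (congr1 (fun f => f X) idg).
  have [A2 /unit_quat_central cp] := spact_id_scalar (Sp_adjqK g.2) idX.
  have p1 : normq ((g.1 : 'M_1) 0 0) = 1.
    have /matrixP/(_ 0 0) := Sp_adjqK g.1; rewrite !mxE big_ord1 !mxE mulq_conjl.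
    by case; rewrite mulr1.
  case: g {idg idX} A2 cp p1 => p A /= A2 cp p1.
  have pE : (p : 'M_1) = ((p : 'M_1) 0 0)%:M.
    by apply/matrixP => i j; rewrite !ord1 mxE.
  rewrite inE; case: (cp p1) => e; rewrite e in A2 pE; apply/orP; [left|right];
    by apply/eqP; congr pair; apply/val_inj; rewrite /= ?A2 ?pE ?scalarN.
rewrite inE => /orP[] /eqP ->; apply/val_inj/val_inj/funext => X.
  exact: spact1.
apply: jordan_ext; rewrite /= ?hpart_spact ?vpart_spact /=.
  by rewrite adjqN adjq1 mulmxN mulmx1 mulNmx mul1mx opprK.
by rewrite adjqN adjq1 mulmxN mulmx1 mulNmx mul1mx opprK.
Qed.
End Action.

(** * Unitary frames adapted to idempotents *)

Section Frame.
Variable R : realType.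

(** A nonzero column of [P], normalised. *)
Lemma unit_vector_in_range n (P : 'M[quat R]_n) :
  P *m P = P -> P != 0 ->
  exists2 v : 'cV[quat R]_n, P *m v = v & adjq v *m v = 1%:M.
Proof.
move=> PP Pn0.
have [k [l Pkl]] : exists k l, P k l != 0.
  apply: contrapT => no; case/eqP: Pn0; apply/matrixP => k l; rewrite mxE.
  by apply/eqP; apply: contrapT => /negP Pkl; apply: no; exists k, l.
pose s := \sum_i normq (P i l).
have s_gt0 : 0 < s.
  rewrite /s (bigD1 k) //=; apply: ltr_wpDr; last exact: normq_gt0.
  by apply: sumr_ge0 => i _; exact: normq_ge0.
have ww : adjq (col l P) *m col l P = s%:A%:M.
  apply/matrixP => i j; rewrite !ord1 !mxE mulr1n scaler_suml.
  by apply: eq_bigr => h _; rewrite !mxE mulq_conjl.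
exists ((Num.sqrt s)^-1%:A *: col l P).
  by rewrite mulmx_realZ colE mulmxA PP.
rewrite adjqZ mulmx_realZ -scalemxAl ww !scale_scalar_mx; congr _%:M.
rewrite !mulr_algl !scalerA -expr2 exprVn sqr_sqrtr ?ltW //.
rewrite mulVf ?scale1r //; exact: lt0r_neq0.
Qed.

(** [P i] and [B j] satisfy the relations of [E_ii] and [E_0j + E_j0]. *)
Variables (P B : 'I_3 -> 'M[quat R]_3).
Hypothesis Pherm : forall i, adjq (P i) = P i.
Hypothesis Bherm : forall j, adjq (B j) = B j.
Hypothesis Pidem : forall i, P i *m P i = P i.
Hypothesis Panti : forall i j, i != j -> P i *m P j + P j *m P i = 0.
Hypothesis P0B : forall j, j != 0 -> P 0 *m B j + B j *m P 0 = B j.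
Hypothesis PB : forall j, j != 0 -> P j *m B j + B j *m P j = B j.
Hypothesis BB : forall j, j != 0 -> B j *m B j = P 0 + P j.
Hypothesis P0_neq0 : P 0 != 0.

Let Porth i j : i != j -> P i *m P j = 0.
Proof.
move=> ij; have /eqP := Panti ij; rewrite addr_eq0 => /eqP PijN.
have PijC : P i *m P j = P j *m P i.
  by rewrite -{1}[P i]Pidem -mulmxA PijN mulmxN mulmxA PijN mulNmx opprK -mulmxA Pidem.
by apply: mxq_double_inj; rewrite addr0 {2}PijC PijN addNr.
Qed.

(** A unit vector [w] with [P 0 w = w] generates the frame: the vectors [w],
    [B 1 w], [B 2 w] lie in the ranges of [P 0], [P 1], [P 2], are orthonormal
    because these ranges are orthogonal and [B j ^ 2 = P 0 + P j], and [B j]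
    exchanges [w] with [B j w].  The matrix with these columns conjugates the
    whole system to the standard one. *)
Lemma frame_unitary : exists2 A : 'M[quat R]_3, adjq A *m A = 1%:M &
  (forall i, adjq A *m P i *m A = delta_mx i i) /\
  (forall j, j != 0 -> adjq A *m B j *m A = delta_mx 0 j + delta_mx j 0).
Proof.
have [w Pw ww] := unit_vector_in_range (Pidem 0) P0_neq0.
pose v j := if j == 0 then w else B j *m w.
have v0 : v 0 = w by [].
have vB j : j != 0 -> B j *m w = v j by rewrite /v => /negPf ->.
have Pv j : P j *m v j = v j.
  have [->|j0] := eqVneq j 0; first by rewrite v0.
  have P0j : P j *m w = 0 by rewrite -Pw mulmxA Porth // mul0mx.
  rewrite -(vB j j0) -{2}(PB j0) mulmxDl -(mulmxA (B j)) P0j mulmx0 addr0.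
  by rewrite mulmxA.
have Pv0 i j : i != j -> P i *m v j = 0.
  by move=> ij; rewrite -Pv mulmxA Porth // mul0mx.
have BBw j : j != 0 -> B j *m v j = w.
  by move=> j0; rewrite -vB // mulmxA BB // mulmxDl Pw -[w in P j *m w]v0 Pv0 // addr0.
have Bv0 j l : j != 0 -> l != 0 -> l != j -> B j *m v l = 0.
  move=> j0 l0 lj.
  have jl : j != l by rewrite eq_sym.
  have Pl0 : 0 != l by rewrite eq_sym.
  (* [B j *m v l] lies in the ranges of both [P 0] and [P j]. *)
  have BP0 : B j *m v l = P 0 *m (B j *m v l).
    by rewrite -{1}(P0B j0) mulmxDl -!mulmxA (Pv0 0 l) // mulmx0 addr0.
  have BPj : B j *m v l = P j *m (B j *m v l).
    by rewrite -{1}(PB j0) mulmxDl -!mulmxA (Pv0 j l) // mulmx0 addr0.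
  by rewrite BP0 BPj mulmxA Porth ?mul0mx // eq_sym.
have vv i j : adjq (v i) *m v j = (i == j)%:R%:M.
  have [->|ij] := eqVneq i j.
    have [->|j0] := eqVneq j 0; first by rewrite v0.
    by rewrite -{1}vB // adjqM Bherm -mulmxA BBw.
  by rewrite -(Pv i) adjqM Pherm -mulmxA Pv0 // mulmx0 raddf0.
pose A : 'M[quat R]_3 := \matrix_(k, l) v l k 0.
have AE (M : 'M[quat R]_3) k l : (adjq A *m M *m A) k l = (adjq (v k) *m (M *m v l)) 0 0.
  rewrite -mulmxA !mxE; apply: eq_bigr => i _; rewrite !mxE; congr (_ * _).
  by apply: eq_bigr => j _; rewrite !mxE.
exists A; last split=> [i | j j0].
- apply/matrixP => k l; rewrite -[adjq A]mulmx1 AE mul1mx vv !mxE.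
  by case: eqP; rewrite // ?mulr1n.
- apply/matrixP => k l; rewrite AE [RHS]mxE.
  have [-> | il] := eqVneq i l.
    by rewrite Pv vv mxE eqxx andbT; case: eqP.
  by rewrite Pv0 // mulmx0 mxE andbF.
apply/matrixP => k l; rewrite AE.
have -> : (delta_mx 0 j + delta_mx j 0 : 'M[quat R]_3) k l =
    ((k == 0) && (l == j))%:R + ((k == j) && (l == 0))%:R by rewrite !mxE.
have [-> | l0] := eqVneq l 0.
  by rewrite v0 vB // vv mxE [0 == j]eq_sym (negPf j0) andbF add0r andbT.
have [-> | lj] := eqVneq l j.
  by rewrite BBw // -v0 vv mxE andbT andbF addr0; case: eqP.
by rewrite Bv0 // mulmx0 mxE !andbF addr0.
Qed.
End Frame.

(** * Automorphisms of the Cayley algebra commuting with gamma *)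

Section CayleyAlgebra.
Variable R : realType.
Implicit Types x y : cayley R.

Definition oneo : cayley R := Cayley 1 0.

Lemma mul0o x : mulo 0 x = 0.
Proof. by case: x => ??; congr Cayley => /=; rewrite !(mul0r, mulr0) ?subr0 ?addr0. Qed.
Lemma mulo0 x : mulo x 0 = 0.
Proof.
by case: x => ??; congr Cayley => /=; rewrite conjq0 !(mul0r, mulr0) ?subr0 ?addr0.
Qed.
Lemma mul1o x : mulo oneo x = x.
Proof.
case: x => m a; congr Cayley => /=;
  by rewrite ?mulr0 ?subr0 ?mul0r ?add0r ?mul1r ?mulr1.
Qed.
Lemma mulo1 x : mulo x oneo = x.
Proof.
by case: x => ??; congr Cayley => /=; rewrite ?conjq0 ?conjq1 !(mul0r, mulr1) ?subr0 ?addr0.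
Qed.

Lemma conjo_fixed x : conjo x = x -> x = q0 (cfst x) *: oneo.
Proof.
case: x => m a [/conjq_fixed {1}-> aN]; congr Cayley; rewrite /= scaler0.
by case: a aN => ???? [????]; congr Quat; lra.
Qed.

Lemma conjo1 : conjo oneo = oneo. Proof. by rewrite /conjo conjq1 oppr0. Qed.

Section GammaAutomorphism.
Variable f : cayley R -> cayley R.
Hypothesis fL : linear f.
Hypothesis fM : {morph f : x y / mulo x y}.
Hypothesis f1 : f oneo = oneo.
Hypothesis fgamma : forall x, f (gammao x) = gammao (f x).

Let fD x y : f (x + y) = f x + f y.
Proof. by have := fL 1 x y; rewrite !scale1r. Qed.
Let fN x : f (- x) = - f x.
Proof.
have f0 : f 0 = 0 by apply: (addrI (f 0)); rewrite -fD !addr0.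
by apply/eqP; rewrite -addr_eq0 -fD addNr f0.
Qed.

Let g m := cfst (f (Cayley m 0)).

Let fH m : f (Cayley m 0) = Cayley (g m) 0.
Proof.
have := fgamma (Cayley m 0); rewrite {1}/gammao /= oppr0 /g.
by case: (f (Cayley m 0)) => n b [/quat_eqN ->].
Qed.

Let e4 : cayley R := Cayley 0 1.

Let f_e4 : exists2 c, normq c = 1 & f e4 = Cayley 0 c.
Proof.
have := fgamma e4; rewrite (_ : gammao e4 = - e4); last first.
  by rewrite /gammao -[RHS]/(Cayley (- 0) (- 1)) oppr0.
rewrite fN; case fe: (f e4) => [n c] [/esym/quat_eqN n0]; exists c; last by rewrite n0.
have : f (mulo e4 e4) = - oneo.
  rewrite -f1 -fN; congr f; congr Cayley; rewrite /= ?conjq1 ?conjq0;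
  by rewrite !(mul0r, mulr0, mul1r) ?sub0r ?addr0 ?oppr0.
by rewrite fM fe n0 => /(congr1 (fun x => q0 (cfst x))) /=; rewrite /normq; lra.
Qed.

(** Commuting with [gamma] preserves both [H] and [H e4].  On [H] the
    automorphism is [m |-> q m conj q]; it sends [e4] to some [c e4] with
    [c] a unit, and [a e4] is the product of [a] and [e4], so
    [a e4 |-> (c q a conj q) e4] and [p = c q]. *)
Lemma cayley_gamma_automorphism :
  exists p q, [/\ normq p = 1, normq q = 1 &
    forall x, f x = Cayley (q * cfst x * conjq q) (p * csnd x * conjq q)].
Proof.
have gL : linear g.
  move=> r m n; rewrite -[RHS]/(cfst (r *: f (Cayley m 0) + f (Cayley n 0))).
  rewrite -fL /g; congr (cfst (f _)); congr Cayley.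
  by rewrite -[LHS]addr0 /= scaler0.
have gM : {morph g : m n / m * n}.
  move=> m n; have mulH h k : mulo (Cayley h 0) (Cayley k 0) = Cayley (h * k) 0 :> cayley R.
    by congr Cayley; rewrite ?conjq0 !(mul0r, mulr0) ?subr0 ?addr0.
  by rewrite /g -mulH fM !fH mulH.
have g1 : g 1 = 1 by rewrite /g -/oneo f1.
have [q nq gE] := quat_automorphism_inner gL gM g1.
have [c nc fe] := f_e4.
exists (c * q), q; split=> // [|[m a]]; first by rewrite normqM nc nq mulr1.
have -> : f (Cayley m a) = Cayley (g m) (c * g a).
  have -> : Cayley m a = Cayley m 0 + mulo (Cayley a 0) e4.
    by congr Cayley; rewrite /= ?conjq1 ?conjq0 !(mul0r, mulr0, mul1r) ?subr0 ?addr0 ?add0r.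
  rewrite fD fM !fH fe; congr Cayley => /=.
    by rewrite !mulr0 subr0 addr0.
  by rewrite mul0r !add0r.
by rewrite !gE !mulrA.
Qed.
End GammaAutomorphism.
End CayleyAlgebra.

(** * Peirce decomposition *)

Section Peirce.
Variable R : realType.
Implicit Types X Y : jordan R.
Implicit Types x y : cayley R.

Lemma conjoK : involutive (@conjo R).
Proof. by case=> ??; rewrite /conjo /= conjqK opprK. Qed.

Fact idemp_subproof i : \matrix_(k, l) (oneo R *+ ((k == i) && (l == i))) \in @hermo R.
Proof.
rewrite inE; apply/eqP/matrixP => k l; rewrite !mxE andbC.
by case: andP => _; rewrite ?conjo1 ?conjo0.
Qed.
Definition idemp i := MkJordan (idemp_subproof i).

Fact offdiag_subproof i j x :
  \matrix_(k, l) (x *+ ((k == i) && (l == j)) + conjo x *+ ((k == j) && (l == i)))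
    \in @hermo R.
Proof.
rewrite inE; apply/eqP/matrixP => k l; rewrite !mxE conjoD addrC.
rewrite [(l == j) && _]andbC [(l == i) && _]andbC.
by congr (_ + _); case: andP => _; rewrite ?conjoK ?conjo0.
Qed.
Definition offdiag i j x := MkJordan (offdiag_subproof i j x).

Lemma idempE i k l : idemp i k l = oneo R *+ ((k == i) && (l == i)).
Proof. by rewrite mxE. Qed.
Lemma offdiagE i j x k l : offdiag i j x k l =
  x *+ ((k == i) && (l == j)) + conjo x *+ ((k == j) && (l == i)).
Proof. by rewrite mxE. Qed.

Lemma offdiag_entry i j x : i != j -> offdiag i j x i j = x.
Proof. by move=> ij; rewrite offdiagE !eqxx (negPf ij) addr0. Qed.

Lemma jordan_entry_ext X Y : (forall k l, X k l = Y k l) -> X = Y.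
Proof. by move=> eXY; apply/val_inj/matrixP. Qed.

Lemma jmulE X Y k l : jmul X Y k l =
  2^-1 *: (\sum_m mulo (X k m) (Y m l) + \sum_m mulo (Y k m) (X m l)).
Proof. by rewrite !mxE. Qed.

Lemma jordan_diag X i : X i i = q0 (cfst (X i i)) *: oneo R.
Proof. exact/conjo_fixed/jordanP. Qed.

Lemma jmul_idempE i X k l :
  jmul (idemp i) X k l = (2^-1 * ((k == i) + (l == i))%:R) *: X k l.
Proof.
rewrite jmulE (bigD1 i) //= big1 => [|m mi]; last by rewrite idempE (negPf mi) andbF mul0o.
rewrite [X in _ + X](bigD1 i) //= [X in _ + (_ + X)]big1 => [|m mi]; last first.
  by rewrite idempE (negPf mi) mulo0.
rewrite !idempE !eqxx andbT !addr0 -scalerA natrD; congr (_ *: _); rewrite scalerDl.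
by congr (_ + _); case: eqP => [->|_]; rewrite ?mul1o ?mulo1 ?scale1r ?mul0o ?mulo0 ?scale0r.
Qed.

(** Four times [jmul (idemp i) (jmul (idemp j) X)] is the Peirce component of
    [X] carried by the entries (i,j) and (j,i). *)
Lemma peirce_offdiag_eq i j X Y : i != j -> X i j = Y i j ->
  jmul (idemp i) (jmul (idemp j) X) = jmul (idemp i) (jmul (idemp j) Y).
Proof.
move=> ij eXY; apply: jordan_entry_ext => k l; rewrite !jmul_idempE.
have eYX : X j i = Y j i by rewrite -jordanP eXY jordanP.
have [->|ki] := eqVneq k i.
  rewrite (negPf ij); have [->|lj] := eqVneq l j; first by rewrite eXY.
  by rewrite mulr0 !scale0r scaler0.
have [->|kj] := eqVneq k j.
  have [->|li] := eqVneq l i; first by rewrite eYX.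
  by rewrite mulr0 !scale0r.
have [->|li] := eqVneq l i; last by rewrite mulr0 !scale0r.
by rewrite (negPf ij) mulr0 !scale0r !scaler0.
Qed.

(** The polynomial [2 L^2 - L] in the multiplication [L] by an idempotent is
    the projection onto its eigenspace 1, as it vanishes at 0 and 1/2. *)
Lemma peirce_diag i X : jmul (idemp i) (jmul (idemp i) X *+ 2 - X) =
  q0 (cfst (X i i)) *: idemp i.
Proof.
apply: jordan_entry_ext => k l; rewrite jmul_idempE.
have -> : (jmul (idemp i) X *+ 2 - X) k l = (jmul (idemp i) X k l) *+ 2 - X k l.
  by rewrite !mxE.
have -> : (q0 (cfst (X i i)) *: idemp i) k l = q0 (cfst (X i i)) *: idemp i k l.
  by rewrite [LHS]mxE.
rewrite jmul_idempE idempE.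
have [->|ki] := eqVneq k i; have [->|li] := eqVneq l i.
- rewrite /= -jordan_diag mulVf ?pnatr_eq0 // !scale1r.
  by rewrite mulr2n addrK.
- rewrite addn0 mulr1 scaler0 -scaler_nat scalerA mulfV ?pnatr_eq0 //.
  by rewrite scale1r subrr scaler0.
- rewrite add0n mulr1 scaler0 -scaler_nat scalerA mulfV ?pnatr_eq0 //.
  by rewrite scale1r subrr scaler0.
by rewrite mulr0 scale0r scaler0.
Qed.

(** As [i], [j], [k] are distinct, the (i,k) entry of [YX] vanishes and that of
    [XY] has the single term through [j]. *)
Lemma jmul_supported i j k X Y : i != j -> j != k -> i != k ->
    (forall m n, m != n -> (m, n) != (i, j) -> (m, n) != (j, i) -> X m n = 0) ->
    (forall m n, m != n -> (m, n) != (j, k) -> (m, n) != (k, j) -> Y m n = 0) ->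
    (forall m, X m m = 0) -> (forall m, Y m m = 0) ->
  jmul X Y i k = 2^-1 *: mulo (X i j) (Y j k).
Proof.
move=> ij jk ik X0 Y0 Xd Yd; rewrite jmulE [X in _ + X]big1 => [|m _]; last first.
  have [->|im] := eqVneq i m; first by rewrite Yd mul0o.
  by rewrite Y0 ?mul0o // xpair_eqE ?(negPf ij) ?(negPf ik).
rewrite addr0 (bigD1 j) //= big1 ?addr0 // => m mj.
have [->|im] := eqVneq i m; first by rewrite Xd mul0o.
by rewrite X0 ?mul0o // xpair_eqE ?(negPf mj) ?(negPf ij) ?andbF.
Qed.

(** An automorphism fixing the diagonal idempotents preserves the Peirce
    components, hence acts on each off-diagonal entry by a linear map [b i j].
    For distinct [i], [j], [k] the product of two components gives
    [b i k (x y) = b i j x * b j k y].  Since the [b 0 j] fix 1, all the [b i j]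
    fix 1; setting [x] or [y] to 1 shows that they coincide, and their common
    value is multiplicative. *)
Section Rigidity.
Variable beta : jordan R -> jordan R.
Hypothesis betaF4 : is_F4 beta.
Hypothesis beta_gamma : forall X, beta (jgamma X) = jgamma (beta X).
Hypothesis beta_idemp : forall i, beta (idemp i) = idemp i.
Hypothesis beta_off : forall j, j != 0 ->
  beta (offdiag 0 j (oneo R)) = offdiag 0 j (oneo R).

Let betaL : linear beta. Proof. by case: betaF4. Qed.
Let betaM : {morph beta : X Y / jmul X Y}. Proof. by case: betaF4. Qed.

Let HB := GRing.isLinear.Build _ _ _ _ beta betaL.
Let bl : {linear jordan R -> jordan R} := HB.pack_for {linear _ -> _} beta HB.
Let blE X : beta X = bl X. Proof. by []. Qed.

Let beta_diag X i : beta X i i = X i i.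
Proof.
have := peirce_diag i (beta X).
have -> : jmul (idemp i) (beta X) *+ 2 - beta X = beta (jmul (idemp i) X *+ 2 - X).
  by rewrite [in RHS]blE linearB linearMn /= betaM beta_idemp.
rewrite -{1}(beta_idemp i) -betaM peirce_diag [in LHS]blE linearZ /= beta_idemp.
move=> /(congr1 (fun Z : jordan R => Z i i)).
rewrite [LHS]mxE [RHS]mxE !idempE !eqxx /=.
by rewrite -!jordan_diag => ->.
Qed.

Let beta_local i j X Y : i != j -> X i j = Y i j -> beta X i j = beta Y i j.
Proof.
move=> ij /(peirce_offdiag_eq ij)/(congr1 beta).
rewrite !betaM !beta_idemp => /(congr1 (fun Z : jordan R => Z i j)).
rewrite !jmul_idempE !eqxx [j == i]eq_sym (negPf ij) !scalerA.
by apply: scalerI; rewrite !mulf_neq0 ?invr_eq0 ?pnatr_eq0.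
Qed.

Let b i j x := beta (offdiag i j x) i j.

Let betaE i j X : i != j -> beta X i j = b i j (X i j).
Proof. by move=> ij; apply: beta_local; rewrite ?offdiag_entry. Qed.

Let b_linear i j : i != j -> linear (b i j).
Proof.
move=> ij c x y.
have -> : c *: x + y = (c *: offdiag i j x + offdiag i j y) i j.
  by rewrite !mxE -!offdiagE !offdiag_entry.
by rewrite -betaE // betaL !mxE.
Qed.

Let b0 i j : i != j -> b i j 0 = 0.
Proof.
move=> ij; have := b_linear ij (-1) 0 0.
by rewrite scaler0 addr0 => ->; rewrite scaleN1r addNr.
Qed.

Let b_mul i j k x y : i != j -> j != k -> i != k ->
  b i k (mulo x y) = mulo (b i j x) (b j k y).
Proof.
move=> ij jk ik.
have off0 p q z m n : p != q -> m != n -> (m, n) != (p, q) -> (m, n) != (q, p) ->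
    offdiag p q z m n = 0.
  move=> pq mn; rewrite !xpair_eqE offdiagE => /negPf -> /negPf ->.
  by rewrite addr0.
have offd p q z m : p != q -> offdiag p q z m m = 0.
  move=> pq; rewrite offdiagE.
  have [->|_] := eqVneq m p; last by rewrite !andbF addr0.
  by rewrite (negPf pq) andbF addr0.
have e1 : jmul (offdiag i j x) (offdiag j k y) i k = 2^-1 *: mulo x y.
  rewrite (jmul_supported ij jk ik) ?offdiag_entry //; move=> *; auto.
have := betaE (jmul (offdiag i j x) (offdiag j k y)) ik.
rewrite betaM (jmul_supported ij jk ik).
- rewrite e1 -[_ *: mulo x y]addr0 b_linear // b0 // addr0.
  by move/scalerI => -> //; rewrite invr_eq0 pnatr_eq0.
- by move=> m n mn *; rewrite betaE // off0 // b0.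
- by move=> m n mn *; rewrite betaE // off0 // b0.
- by move=> m; rewrite beta_diag offd.
- by move=> m; rewrite beta_diag offd.
Qed.

Let b_conj i j x : i != j -> b j i (conjo x) = conjo (b i j x).
Proof.
move=> ij; rewrite /b jordanP [RHS]betaE 1?eq_sym //; congr (b j i _).
by rewrite -jordanP offdiag_entry.
Qed.

Let b1 i j : i != j -> b i j (oneo R) = oneo R.
Proof.
have b01 k : k != 0 -> b 0 k (oneo R) = oneo R.
  by move=> k0; rewrite /b beta_off // offdiag_entry // eq_sym.
have b10 k : k != 0 -> b k 0 (oneo R) = oneo R.
  by move=> k0; rewrite -[oneo R in LHS]conjo1 b_conj 1?eq_sym // b01 // conjo1.
have [->|i0] := eqVneq i 0; first by rewrite eq_sym; exact: b01.
have [->|j0] := eqVneq j 0; first exact: b10.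
have j0' : 0 != j by rewrite eq_sym.
move=> ij; rewrite -[oneo R in LHS]mulo1 (b_mul _ _ i0 j0' ij).
by rewrite b01 // b10 // mulo1.
Qed.

Let b_row i j k x : i != j -> j != k -> i != k -> b i k x = b i j x.
Proof. by move=> ij jk ik; rewrite -{1}[x]mulo1 (b_mul _ _ ij jk ik) b1 // mulo1. Qed.

Let b_col i j k x : i != j -> j != k -> i != k -> b i k x = b j k x.
Proof. by move=> ij jk ik; rewrite -{1}[x]mul1o (b_mul _ _ ij jk ik) b1 // mul1o. Qed.

Let b_const i j x : i != j -> b i j x = b 0 1 x.
Proof.
have e02 : b 0 2%R x = b 0 1 x by exact: b_row.
have e12 : b 1 2%R x = b 0 1 x by rewrite -e02; symmetry; exact: b_col.
have e10 : b 1 0 x = b 0 1 x by rewrite -e12; exact: b_row.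
have e20 : b 2%R 0 x = b 0 1 x by rewrite -e10; exact: b_col.
have e21 : b 2%R 1 x = b 0 1 x by rewrite -e20; exact: b_row.
by move: i j; apply: ord3_cases; apply: ord3_cases.
Qed.

(** The formula covers the diagonal too: diagonal entries are real, and [f]
    fixes the reals. *)
Lemma peirce_rigidity : exists f : cayley R -> cayley R,
  [/\ linear f, {morph f : x y / mulo x y}, f (oneo R) = oneo R,
      forall x, f (gammao x) = gammao (f x) &
      forall X i j, beta X i j = f (X i j)].
Proof.
have n01 : 0 != 1 :> 'I_3 by []; exists (b 0 1); split.
- exact: b_linear.
- move=> x y; rewrite -(b_const (i := 0) (j := 2%R)) //.
  by rewrite (b_mul (j := 1)) // [b 1 _ _]b_const.
- exact: b1.
- move=> x; have := beta_gamma (offdiag 0 1 x).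
  move=> /(congr1 (fun Z : jordan R => Z 0 1)); rewrite betaE //.
  by rewrite [RHS]mxE [X in b 0 1 X]mxE offdiag_entry.
move=> X i j; have [<-|ij] := eqVneq i j; last by rewrite betaE // b_const.
rewrite beta_diag [in RHS]jordan_diag -[_ *: _ in RHS]addr0 b_linear // b0 // b1 //.
by rewrite addr0 -jordan_diag.
Qed.
End Rigidity.
End Peirce.

(** * Surjectivity onto the centraliser of gamma *)

Section Surjectivity.
Variable R : realType.
Implicit Types X Y Z : jordan R.

Lemma cfst_mulrb (x : cayley R) (c : bool) : cfst (x *+ c) = cfst x *+ c.
Proof. by case: c. Qed.
Lemma csnd_mulrb (x : cayley R) (c : bool) : csnd (x *+ c) = csnd x *+ c.
Proof. by case: c. Qed.

Lemma hpart_idemp i : hpart (idemp R i) = delta_mx i i.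
Proof. by apply/matrixP => k l; rewrite mxE idempE cfst_mulrb mxE. Qed.
Lemma vpart_idemp i : vpart (idemp R i) = 0.
Proof. by apply/rowP => k; rewrite mxE idempE csnd_mulrb mxE mul0rn. Qed.
Lemma hpart_offdiag1 i j :
  hpart (offdiag i j (oneo R)) = delta_mx i j + delta_mx j i.
Proof.
by apply/matrixP => k l; rewrite mxE offdiagE /= !cfst_mulrb !mxE /= conjq1.
Qed.
Lemma vpart_offdiag1 i j : vpart (offdiag i j (oneo R)) = 0.
Proof.
apply/rowP => k; rewrite mxE offdiagE /= !csnd_mulrb !mxE /= oppr0.
by rewrite !mul0rn addr0.
Qed.

Lemma vpart_eq0 X : vpart X = 0 <-> jgamma X = X.
Proof.
split=> [v0 | gX].
  by apply: jordan_ext; rewrite ?hpart_jgamma ?vpart_jgamma ?v0 ?oppr0.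
have /rowP vN := vpart_jgamma X; rewrite gX in vN.
by apply/rowP => i; have := vN i; rewrite !mxE => /quat_eqN.
Qed.

Lemma hpart0 : hpart 0 = 0 :> 'M[quat R]_3.
Proof. by apply/matrixP => i j; rewrite !mxE. Qed.
Lemma hpartD X Y : hpart (X + Y) = hpart X + hpart Y.
Proof. by have := hpart_linear 1 X Y; rewrite !scale1r. Qed.
Lemma vpartD X Y : vpart (X + Y) = vpart X + vpart Y.
Proof. by have := vpart_linear 1 X Y; rewrite !scale1r. Qed.
Lemma hpartZ c X : hpart (c *: X) = c%:A *: hpart X.
Proof. by have := hpart_linear c X 0; rewrite !addr0 hpart0 addr0. Qed.
Lemma vpart0 : vpart (0 : jordan R) = 0.
Proof. by apply/rowP => i; rewrite !mxE. Qed.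
Lemma vpartZ c X : vpart (c *: X) = c%:A *: vpart X.
Proof. by have := vpart_linear c X 0; rewrite !addr0 vpart0 addr0. Qed.

Lemma hpart_jmul_quat X Y : vpart X = 0 -> vpart Y = 0 ->
  hpart (jmul X Y) = 2^-1%:A *: (hpart X *m hpart Y + hpart Y *m hpart X).
Proof.
move=> vX vY; rewrite hpart_jmul vX vY mulmx0 !subr0.
by rewrite /retr raddf0 scale0r raddf0 addr0.
Qed.

Lemma vpart_jmul_quat X Y : vpart X = 0 -> vpart Y = 0 -> vpart (jmul X Y) = 0.
Proof. by move=> vX vY; rewrite vpart_jmul vX vY !mul0mx !scaler0 !subr0 addr0 scaler0. Qed.

Section Alpha.
Variable alpha : F4 R.
Hypothesis alphaC : commutes_gamma alpha.

Lemma F4_jgamma X : alpha (jgamma X) = jgamma (alpha X).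
Proof.
have /eqP /(congr1 (fun f : F4 R => f X)) /= -> // := alphaC.
Qed.

Lemma F4_vpart0 X : vpart X = 0 -> vpart (alpha X) = 0.
Proof. by move/vpart_eq0 => gX; apply/vpart_eq0; rewrite -F4_jgamma gX. Qed.

Let alphaL : linear alpha. Proof. by have [] := F4P alpha. Qed.
Let alphaM : {morph alpha : X Y / jmul X Y}. Proof. by have [] := F4P alpha. Qed.
Let alphaD X Y : alpha (X + Y) = alpha X + alpha Y.
Proof. by have := alphaL 1 X Y; rewrite !scale1r. Qed.
Let alpha0 : alpha 0 = 0.
Proof. by apply: (addrI (alpha 0)); rewrite -alphaD !addr0. Qed.
Let alphaZ c X : alpha (c *: X) = c *: alpha X.
Proof. by have := alphaL c X 0; rewrite !addr0 alpha0 addr0. Qed.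

(** On J(3,H) the Jordan product is half the anticommutator of associative
    matrices, so an automorphism that preserves J(3,H) transports relations
    between anticommutators.  [Z] ranges over all of J(3,H) to cover
    right-hand sides such as [E_ii + E_ii] and [0]. *)
Lemma F4_anticommutator X Y Z : vpart X = 0 -> vpart Y = 0 -> vpart Z = 0 ->
    hpart X *m hpart Y + hpart Y *m hpart X = hpart Z ->
  hpart (alpha X) *m hpart (alpha Y) + hpart (alpha Y) *m hpart (alpha X)
    = hpart (alpha Z).
Proof.
move=> vX vY vZ eZ.
have XY : jmul X Y = 2^-1 *: Z.
  apply: jordan_ext; first by rewrite hpart_jmul_quat // hpartZ eZ.
  by rewrite vpart_jmul_quat // vpartZ vZ scaler0.
have := congr1 (@hpart R) (alphaM X Y).
rewrite XY alphaZ hpartZ hpart_jmul_quat ?F4_vpart0 //.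
move=> /(congr1 ( *:%R (2%:A : quat R))); rewrite !scalerA mulr_algl scalerA.
by rewrite mulfV ?pnatr_eq0 // scale1r !scale1r.
Qed.

(** The images of [E_ii] and [E_0j + E_j0] are quaternionic and satisfy the same
    relations, so a unitary frame [A] adapted to them exists, and acting by
    [A^*] moves them back. *)
Lemma F4_gamma_frame : exists2 A : 'M[quat R]_3, adjq A *m A = 1%:M &
  (forall i, spact 1%:M (adjq A) (alpha (idemp R i)) = idemp R i) /\
  (forall j, j != 0 -> spact 1%:M (adjq A) (alpha (offdiag 0 j (oneo R)))
                       = offdiag 0 j (oneo R)).
Proof.
pose P i := hpart (alpha (idemp R i)).
pose B j := hpart (alpha (offdiag 0 j (oneo R))).
have vE := vpart_idemp; have vF := vpart_offdiag1.
have vEE i j : vpart (idemp R i + idemp R j) = 0 by rewrite vpartD !vE addr0.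
have [||||||||A hA [AP AB]] := @frame_unitary R P B.
- by move=> i; exact: hpart_herm.
- by move=> j; exact: hpart_herm.
- move=> i; apply: mxq_double_inj; rewrite /P -hpartD -alphaD.
  apply: F4_anticommutator => //.
  by rewrite hpartD !hpart_idemp mul_delta_mx.
- move=> i j ij; rewrite /P -hpart0 -alpha0; apply: F4_anticommutator; rewrite ?vpart0 //.
  by rewrite hpart0 !hpart_idemp !mul_delta_mx_cond [j == i]eq_sym (negPf ij) addr0.
- move=> j j0; apply: F4_anticommutator => //.
  rewrite hpart_idemp !hpart_offdiag1 mulmxDr mulmxDl !mul_delta_mx_cond.
  by rewrite [0 == j]eq_sym (negPf j0) eqxx addr0 add0r.
- move=> j j0; apply: F4_anticommutator => //.
  rewrite hpart_idemp !hpart_offdiag1 mulmxDr mulmxDl !mul_delta_mx_cond.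
  by rewrite [0 == j]eq_sym (negPf j0) eqxx addr0 add0r addrC.
- move=> j j0; apply: mxq_double_inj; rewrite /P /B -hpartD -alphaD -hpartD -alphaD.
  apply: F4_anticommutator => //; first by rewrite vpartD vEE addr0.
  rewrite !hpartD !hpart_idemp !hpart_offdiag1 mulmxDr !mulmxDl !mul_delta_mx_cond.
  by rewrite [0 == j]eq_sym (negPf j0) !eqxx !addr0 !add0r !mulr1n [delta_mx j j + _]addrC.
- apply/eqP => P0; have : alpha (idemp R 0) = alpha 0.
    by rewrite alpha0; apply: jordan_ext; rewrite ?vpart0 ?hpart0 // F4_vpart0.
  have [_ /bij_inj alphaI _] := F4P alpha.
  move=> /alphaI /(congr1 (@hpart R)) /matrixP/(_ 0 0).
  by rewrite hpart_idemp hpart0 !mxE => /eqP; rewrite oner_eq0.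
exists A => //; split=> [i | j j0]; apply: jordan_ext.
- by rewrite hpart_spact adjqK AP hpart_idemp.
- by rewrite vpart_spact F4_vpart0 ?vE // mulmx0 mul0mx.
- by rewrite hpart_spact adjqK AB // hpart_offdiag1.
by rewrite vpart_spact F4_vpart0 ?vF // mulmx0 mul0mx.
Qed.
End Alpha.

Fact Sp_scalar_subproof n (q : quat R) : normq q = 1 ->
  adjq (q%:M : 'M_n) *m q%:M == 1%:M.
Proof.
by move=> nq; rewrite adjq_scalar mul_scalar_mx scale_scalar_mx mulq_conjl nq scale1r.
Qed.

(** After composition with the action of [A^*], the automorphism is entrywise
    [m + a e4 |-> q m conj q + (p a conj q) e4], which is the action of
    [(p, q E)]. *)
Lemma spact_F4_gamma_surj (alpha : F4_gamma R) : exists g, spact_F4_gamma g = alpha.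
Proof.
case: alpha => alpha alphaC.
have [A hA [fixE fixF]] := F4_gamma_frame alphaC.
have AA : A *m adjq A = 1%:M by exact: mulmxq1C.
pose A' : Sp R 3 := MkSp (introT eqP hA).
pose beta := spact_F4 (1, A'^-1)%g \o alpha.
have betaF4 : is_F4 beta by exact: F4P (spact_F4 (1, A'^-1) * alpha)%g.
have betaC X : beta (jgamma X) = jgamma (beta X).
  by rewrite /beta /= F4_jgamma // spact_jgamma.
have [f [fL fM f1 fC betaf]] := peirce_rigidity betaF4 betaC fixE fixF.
have [p [q [np nq fE]]] := cayley_gamma_automorphism fL fM f1 fC.
have betaE X : beta X = spact p%:M q%:M X.
  have right_scalar m n (M : 'M[quat R]_(m, n)) c i j : (M *m c%:M) i j = M i j * c.
    rewrite mxE (bigD1 j) //= mxE eqxx big1 ?addr0 // => k /negPf kj.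
    by rewrite mxE kj mulr0.
  have hE Y i j : hpart Y i j = cfst (Y i j) by rewrite mxE.
  have vE Y i : vpart Y 0 i = csnd (Y (i + 1) (i + 2)) by rewrite mxE.
  apply: jordan_ext; rewrite [RHS](hpart_spact, vpart_spact) adjq_scalar mul_scalar_mx.
    by apply/matrixP => i j; rewrite right_scalar hE betaf fE !mxE.
  by apply/rowP => i; rewrite right_scalar vE betaf fE !mxE.
exists (MkSp (Sp_scalar_subproof 1 np),
        (A' * MkSp (Sp_scalar_subproof 3 nq))%g).
apply/val_inj/val_inj/funext => X; rewrite /= -[p%:M]mul1mx spact_mul -betaE.
by rewrite /beta /= -spact_mul AA mul1mx spact1.
Qed.
End Surjectivity.

Theorem theorem2p11p2 (R : realType) :
  group_isomorphic (F4_gamma R)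
    (quotient_group (Sp R 1 * Sp R 3)%type (Z2 R)).
Proof.
apply: (first_isomorphism (@spact_F4_gammaM R)).
  exact: spact_F4_gamma_surj.
exact: spact_F4_gamma_ker.
Qed.
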